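(* Let $A$ be a finite set, let $t\notin A$, and let $G=\langle A\cup\{t\}\mid w=1\rangle$ be a one-relator group whose defining relator $w$ has $t$-exponent sum $\sigma_t(w)=0$. Let $\overline{w}$ be the word over $\{x_i : x\in A,\ i\in\mathbb{Z}\}^{\pm1}$ obtained from $w$ by Magnus rewriting with respect to $t$. Assume that for some letter $x\in A$, the letter $x_{\max(x)}$ appears exactly once in $\overline{w}$ and the letter $x_{\min(x)}$ also appears exactly once in $\overline{w}$, where $$\max(x)=\max\{i\mid x_i\text{ appears in }\overline{w}\},\qquad \min(x)=\min\{i\mid x_i\text{ appears in }\overline{w}\}.$$ Let $w_1,\dots,w_k$ be elements of the free group on $A\cup\{t\}$, each with $t$-exponent sum $\geq 0$. Then membership in the submonoid $M$ of $G$ generated by (the elements represented by) $w_1,\dots,w_k$ is decidable.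
   Context: The $t$-exponent sum of a word $u$ is the number of occurrences of $t$ in $u$ minus the number of occurrences of $t^{-1}$ in $u$. A letter $y$ appears in a word if $y$ or $y^{-1}$ is a letter of the word; it appears exactly once if there is exactly one occurrence in total of $y$ or $y^{-1}$. Magnus rewriting with respect to $t$: for each occurrence of a letter $x^{\epsilon}$ in $w$ with $x\in A$, $\epsilon=\pm1$, write $w\equiv w' x^{\epsilon} w''$ and replace that occurrence by $x_i^{\epsilon}$, where $i$ is the $t$-exponent sum of $w'$; finally delete all occurrences of $t^{\pm 1}$. The result is $\overline{w}$. Equivalently, $x_i$ stands for $t^i x t^{-i}$, and $G$ has the presentation with generators $t$ and $x_i$ ($x\in A$, $i\in\mathbb{Z}$) and relations $\overline{w}=1$ and $t x_i t^{-1}=x_{i+1}$ ($x\in A$, $i\in\mathbb{Z}$). For a group $G$ generated by a finite set $B$ and a submonoid $M\leq G$ generated by a finite set, membership in $M$ is decidable if there is an algorithm that takes any word over $B\cup B^{-1}$ and decides whether the element of $G$ it represents belongs to $M$. *)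

(* Defs.v *)
From HB Require Import structures.
From mathcomp Require Import all_boot all_order all_algebra.
From mathcomp Require Import generic_quotient boolp.

Set Implicit Arguments.
Unset Strict Implicit.
Unset Printing Implicit Defensive.

Local Open Scope quotient_scope.

(* Words over X^{+1,-1}: (x, true) is the letter x, (x, false) is x^-1. *)
Definition word (X : Type) : Type := seq (X * bool).

Definition occurrences (X : eqType) (y : X) (u : word X) : nat :=
  count (fun l => l.1 == y) u.

Definition appears (X : eqType) (y : X) (u : word X) : Prop :=
  0 < occurrences y u.

Definition appears_once (X : eqType) (y : X) (u : word X) : Prop :=
  occurrences y u = 1.

Definition letter_sign (e : bool) : int := (if e then 1 else -1)%R.

Definition exponent_sum (X : eqType) (y : X) (u : word X) : int :=
  (\sum_(l <- u | l.1 == y) letter_sign l.2)%R.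

(* The group < X | R >: words modulo the congruence generated by free
   cancellation and by r = 1 for r in R. *)
Inductive pres_eq (X : Type) (R : word X -> Prop) : word X -> word X -> Prop :=
| pres_refl u : pres_eq R u u
| pres_sym u v : pres_eq R u v -> pres_eq R v u
| pres_trans u v z : pres_eq R u v -> pres_eq R v z -> pres_eq R u z
| pres_cancel u v x e : pres_eq R (u ++ (x, e) :: (x, ~~ e) :: v) (u ++ v)
| pres_rel u v r : R r -> pres_eq R (u ++ r ++ v) (u ++ v).

Section PresentedGroup.
Variables (X : choiceType) (R : word X -> Prop).

Definition pres_rel_bool : rel (word X) := fun u v => `[< pres_eq R u v >].

Lemma pres_rel_equiv : equiv_class_of pres_rel_bool.
Proof.
split.
- by move=> u; apply/asboolP; exact: pres_refl.
- by move=> u v; apply/asboolP/asboolP; exact: pres_sym.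
- move=> v u z /asboolP uv /asboolP vz; apply/asboolP.
  exact: pres_trans uv vz.
Qed.

Canonical pres_equiv_rel := EquivRelPack pres_rel_equiv.

Definition presented_group : Type := {eq_quot pres_equiv_rel}.

HB.instance Definition _ := Choice.on presented_group.

Definition class_of (u : word X) : presented_group := \pi_{eq_quot pres_equiv_rel} u.

Lemma class_ofP u v : class_of u = class_of v <-> pres_eq R u v.
Proof.
split=> [/eqP|uv]; first by rewrite eqmodE => /asboolP.
by apply/eqP; rewrite eqmodE; apply/asboolP.
Qed.

Lemma class_of_repr (a : presented_group) : class_of (repr a) = a.
Proof. exact: reprK. Qed.

Lemma repr_class_of u : pres_eq R (repr (class_of u)) u.
Proof. by apply/class_ofP; rewrite class_of_repr. Qed.

Lemma pres_eq_catl u v z : pres_eq R u v -> pres_eq R (z ++ u) (z ++ v).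
Proof.
elim=> [u0|u0 v0 _ IH|u0 v0 z0 _ IH _ IH'|u0 v0 x e|u0 v0 r Rr].
- exact: pres_refl.
- exact: pres_sym.
- exact: pres_trans IH'.
- by rewrite !catA; exact: pres_cancel.
- by rewrite (catA z u0 (r ++ v0)) (catA z u0 v0); exact: pres_rel.
Qed.

Lemma pres_eq_catr u v z : pres_eq R u v -> pres_eq R (u ++ z) (v ++ z).
Proof.
elim=> [u0|u0 v0 _ IH|u0 v0 z0 _ IH _ IH'|u0 v0 x e|u0 v0 r Rr].
- exact: pres_refl.
- exact: pres_sym.
- exact: pres_trans IH'.
- by rewrite -!catA /=; exact: pres_cancel.
- by rewrite -!catA; exact: pres_rel.
Qed.

Lemma pres_eq_cat u u' v v' :
  pres_eq R u u' -> pres_eq R v v' -> pres_eq R (u ++ v) (u' ++ v').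
Proof.
by move=> uu' vv'; apply: pres_trans (pres_eq_catr v uu') (pres_eq_catl u' vv').
Qed.

Definition word_inv (u : word X) : word X := rev [seq (l.1, ~~ l.2) | l <- u].

Lemma word_invK : involutive word_inv.
Proof.
move=> u; rewrite /word_inv map_rev revK -map_comp map_id_in //.
by case=> x e _ /=; rewrite negbK.
Qed.

Lemma pres_eq_mulV u : pres_eq R (u ++ word_inv u) [::].
Proof.
elim: u => [|[x e] u IH]; first exact: pres_refl.
rewrite /word_inv /= rev_cons -cats1 -/(word_inv u) catA.
apply: (pres_trans (v := [:: (x, e)] ++ [::] ++ [:: (x, ~~ e)])).
  by rewrite -cat1s; apply: pres_eq_catl; apply: pres_eq_catr.
exact: (pres_cancel R [::] [::]).
Qed.

Lemma pres_eq_Vmul u : pres_eq R (word_inv u ++ u) [::].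
Proof. by rewrite -{2}[u]word_invK; exact: pres_eq_mulV. Qed.

Definition pres_one : presented_group := class_of [::].
Definition pres_mul (a b : presented_group) : presented_group :=
  class_of (repr a ++ repr b).
Definition pres_inv (a : presented_group) : presented_group :=
  class_of (word_inv (repr a)).

Lemma pres_mulE u v : pres_mul (class_of u) (class_of v) = class_of (u ++ v).
Proof. by apply/class_ofP; apply: pres_eq_cat; exact: repr_class_of. Qed.

Lemma pres_mulA : associative pres_mul.
Proof.
move=> a b c; rewrite -[a]class_of_repr -[b]class_of_repr -[c]class_of_repr.
by rewrite !pres_mulE catA.
Qed.

Lemma pres_mul1 : left_id pres_one pres_mul.
Proof. by move=> a; rewrite -[a]class_of_repr pres_mulE. Qed.

Lemma pres_mulr1 : right_id pres_one pres_mul.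
Proof. by move=> a; rewrite -[a]class_of_repr pres_mulE cats0. Qed.

Lemma pres_mulV : left_inverse pres_one pres_inv pres_mul.
Proof.
move=> a; rewrite -{2}[a]class_of_repr pres_mulE.
by apply/class_ofP; exact: pres_eq_Vmul.
Qed.

Lemma pres_mulrV : right_inverse pres_one pres_inv pres_mul.
Proof.
move=> a; rewrite -{1}[a]class_of_repr pres_mulE.
by apply/class_ofP; exact: pres_eq_mulV.
Qed.

HB.instance Definition _ := isGroup.Build presented_group
  pres_mulA pres_mul1 pres_mulr1 pres_mulV pres_mulrV.

Definition pres_gen (x : X) : presented_group := class_of [:: (x, true)].

End PresentedGroup.

Definition word_eval (X : Type) (G : groupType) (b : X -> G) (u : word X) : G :=
  (\prod_(l <- u) (if l.2 then b l.1 else (b l.1)^-1))%g.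

Lemma word_eval_pres_gen (X : choiceType) (R : word X -> Prop) (u : word X) :
  word_eval (@pres_gen X R) u = class_of R u.
Proof.
rewrite /word_eval; elim: u => [|[x e] u IH]; first by rewrite big_nil.
rewrite big_cons IH /=.
suff -> : (if e then pres_gen R x else (pres_gen R x)^-1)%g = class_of R [:: (x, e)].
  exact: pres_mulE.
case: e => //; apply/class_ofP.
rewrite -[[:: (x, false)]]/(word_inv [:: (x, true)]).
set r := repr _; have rx : pres_eq R r [:: (x, true)] by exact: repr_class_of.
have inv_r : pres_eq R (word_inv r ++ r) [::] by exact: pres_eq_Vmul.
apply: (pres_trans (v := word_inv r ++ [:: (x, true)] ++ word_inv [:: (x, true)])).
  rewrite -[X in pres_eq R X]cats0; apply: pres_eq_catl.
  by apply: pres_sym; exact: pres_eq_mulV.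
rewrite catA -[X in pres_eq R _ X]cat0s; apply: pres_eq_catr.
apply: pres_trans inv_r; apply: pres_eq_catl; exact: pres_sym.
Qed.

Inductive gen_submonoid (M : monoidType) (S : M -> Prop) : M -> Prop :=
| gen_submonoid1 : gen_submonoid S 1%g
| gen_submonoid_gen a : S a -> gen_submonoid S a
| gen_submonoidM a b :
    gen_submonoid S a -> gen_submonoid S b -> gen_submonoid S (a * b)%g.

(* The total recursive functions nat^n -> nat: the least class that contains
   the constant 0, the successor and the projections and is closed under
   composition, primitive recursion and minimisation of regular functions. *)
Inductive recursive : forall n : nat, (n.-tuple nat -> nat) -> Prop :=
| rec_zero n : recursive (fun _ : n.-tuple nat => 0)
| rec_succ : recursive (fun v : 1.-tuple nat => (thead v).+1)
| rec_proj n (i : 'I_n) : recursive (fun v : n.-tuple nat => tnth v i)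
| rec_comp m n (f : m.-tuple nat -> nat) (g : 'I_m -> n.-tuple nat -> nat) :
    recursive f -> (forall i, recursive (g i)) ->
    recursive (fun v : n.-tuple nat => f [tuple g i v | i < m])
| rec_prim n (f : n.-tuple nat -> nat) (g : n.+2.-tuple nat -> nat) :
    recursive f -> recursive g ->
    recursive (fun v : n.+1.-tuple nat =>
      iteri (thead v) (fun k r => g [tuple of k :: r :: behead_tuple v])
        (f (behead_tuple v)))
| rec_mu n (f : n.+1.-tuple nat -> nat) (h : n.-tuple nat -> nat) :
    recursive f ->
    (forall v, f [tuple of h v :: v] = 0) ->
    (forall v y, y < h v -> f [tuple of y :: v] <> 0) ->
    recursive h
| rec_ext n (f g : n.-tuple nat -> nat) : recursive f -> f =1 g -> recursive g.

(* Goedel number of a word over a finite alphabet; CodeSeq.code is a bijection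
   from seq nat to nat. *)
Definition word_code (B : finType) (u : word B) : nat :=
  CodeSeq.code [seq (enum_rank l.1).*2 + l.2 | l : B * bool <- u].

Definition decidable_words (B : finType) (P : word B -> Prop) : Prop :=
  exists2 f : 1.-tuple nat -> nat, recursive f
    & forall u : word B, P u <-> f [tuple word_code u] = 1.

Definition decidable_membership (B : finType) (G : groupType) (b : B -> G)
    (M : G -> Prop) : Prop :=
  decidable_words (fun u : word B => M (word_eval b u)).

(* Over A and a further letter t, the alphabet is option A, with t = None. *)
Definition one_relator_group (A : finType) (w : word (option A)) : groupType :=
  presented_group (fun r => r = w).

Definition letter_class (A : finType) (w : word (option A)) :
    option A -> one_relator_group w :=
  @pres_gen (option A) (fun r => r = w).

(* The letter x_i is the pair (x, i); the accumulator i is the t-exponent sum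
   of the part of the word already read. *)
Fixpoint magnus_from (A : Type) (i : int) (w : word (option A)) :
    word (A * int) :=
  match w with
  | [::] => [::]
  | (None, e) :: w' => magnus_from (i + letter_sign e)%R w'
  | (Some x, e) :: w' => (x, i, e) :: magnus_from i w'
  end.

Definition magnus (A : Type) (w : word (option A)) : word (A * int) :=
  magnus_from 0%R w.

Definition is_max_index (A : eqType) (u : word (A * int)) (x : A) (p : int) : Prop :=
  appears (x, p) u /\ forall i : int, appears (x, i) u -> (i <= p)%R.

Definition is_min_index (A : eqType) (u : word (A * int)) (x : A) (q : int) : Prop :=
  appears (x, q) u /\ forall i : int, appears (x, i) u -> (q <= i)%R.

(* Main.v *)
Require Import Defs.
From mathcomp Require Import all_boot all_order all_algebra.
From mathcomp Require Import zify.
Import Order.TTheory GRing.Theory Num.Theory.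

Set Implicit Arguments.
Unset Strict Implicit.
Unset Printing Implicit Defensive.

(** Conjugation by t moves the problem into a free group. The kernel of the
    t-exponent map of G is generated by the elements x_i = t^i x t^-i. The
    letter x_p of largest index occurs once in the rewritten relator, so the
    relator and its translates express every x_i with i >= p through letters of
    smaller index; likewise x_q, of smallest index, lets every x_i with i < q be
    eliminated. Hence the kernel is the free group F on the y_j with y <> x and
    the x_i with q <= i < p, and conjugation by t is the automorphism of F that
    shifts indices by one and sends x_(p-1) to the solution of the relator for
    x_p. Every word u thus has a computable normal form z t^n with z a word over
    the basis of F ([normal_from]), and words equal in G have freely equal normal
    forms ([normal_eq_pres_eq]): G is the semidirect product of F and the
    integers.

    The generators of M have exponents >= 0, so a product of them that has
    exponent n visits only the exponents 0, ..., n. Let w_i = z_i t^(s_i) be the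
    normal forms of the generators. The elements z t^n of M are then those for
    which z is, in F, the label of a path from 0 to n in the finite automaton
    on exponents with an edge from m to m + s_i labelled by t^m z_i t^-m, for all
    i and all m <= n ([decide_submonoid]).

    Membership in such a rational subset of a free group is decided by
    saturation, after Benois: join two states by a silent move as soon as some
    path between them has a label that is freely trivial; then an element belongs
    to the subset exactly when its reduced word can be read ([acceptingP]).

    It remains to see that this procedure is a recursive function. Functions
    between countable types that are tracked by a recursive function on codes are
    closed under the usual constructions on lists ([computable]), and the
    procedure is written with these constructions only ([computable_decide]). *)

(** * Recursive arithmetic *)

(** Curried forms of [recursive], which keep the tuples out of the sequel. *)
Definition recursive1 (f : nat -> nat) :=
  recursive (fun v : 1.-tuple nat => f (thead v)).
Definition recursive2 (f : nat -> nat -> nat) :=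
  recursive (fun v : 2.-tuple nat => f (tnth v ord0) (tnth v ord_max)).
Definition recursive3 (f : nat -> nat -> nat -> nat) :=
  recursive (fun v : 3.-tuple nat =>
    f (tnth v ord0) (tnth v (lift ord0 ord0)) (tnth v ord_max)).

Lemma recursive1_comp n f (a : n.-tuple nat -> nat) :
  recursive1 f -> recursive a -> recursive (fun v => f (a v)).
Proof.
move=> rf ra; apply: rec_ext (rec_comp (g := fun _ => a) rf (fun _ => ra)) _ => v /=.
by rewrite /thead tnth_mktuple.
Qed.

Lemma recursive2_comp n f (a b : n.-tuple nat -> nat) :
  recursive2 f -> recursive a -> recursive b -> recursive (fun v => f (a v) (b v)).
Proof.
move=> rf ra rb.
pose g (i : 'I_2) := if i == ord0 then a else b.
have rg i : recursive (g i) by rewrite /g; case: ifP.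
by apply: rec_ext (rec_comp rf rg) _ => v /=; rewrite !tnth_mktuple.
Qed.

Lemma recursive3_comp n f (a b c : n.-tuple nat -> nat) :
  recursive3 f -> recursive a -> recursive b -> recursive c ->
  recursive (fun v => f (a v) (b v) (c v)).
Proof.
move=> rf ra rb rc.
pose g (i : 'I_3) := if i == ord0 then a else if i == ord_max then c else b.
have rg i : recursive (g i) by rewrite /g; case: ifP => // _; case: ifP.
by apply: rec_ext (rec_comp rf rg) _ => v /=; rewrite !tnth_mktuple.
Qed.

Lemma recursive_const n (c : nat) : recursive (fun _ : n.-tuple nat => c).
Proof.
elim: c => [|c IH]; first exact: rec_zero.
exact: (recursive1_comp rec_succ IH).
Qed.

Lemma recursive2_iteri F G :
  recursive1 F -> recursive3 G -> recursive2 (fun m e => iteri m (fun k r => G k r e) (F e)).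
Proof.
move=> rF rG; apply: rec_ext (rec_prim rF rG) _ => v /=.
have -> : thead (behead_tuple v) = tnth v ord_max.
  by rewrite /thead !(tnth_nth 0) /= nth_behead.
apply: eq_iteri => k r.
by rewrite !(tnth_nth 0) /= nth_behead.
Qed.

Lemma recursive1_id : recursive1 id.
Proof. exact: rec_proj. Qed.

Lemma recursive2_fst : recursive2 (fun x _ => x).
Proof. exact: rec_proj. Qed.

Lemma recursive2_snd : recursive2 (fun _ y => y).
Proof. exact: rec_proj. Qed.

Lemma recursive1_succ : recursive1 succn.
Proof. exact: rec_succ. Qed.

Lemma recursive1_iteri (c : nat) G :
  recursive2 G -> recursive1 (fun m => iteri m G c).
Proof.
move=> rG; apply: (recursive2_comp (f := fun m _ => iteri m G c)).
- apply: (recursive2_iteri (F := fun _ => c) (G := fun k r _ => G k r)).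
    exact: recursive_const.
  by apply: recursive2_comp => //; exact: rec_proj.
- exact: rec_proj.
- exact: (recursive_const 1 0).
Qed.

Lemma recursive2_add : recursive2 addn.
Proof.
have rG : recursive3 (fun _ r _ => r.+1).
  by apply: (recursive1_comp recursive1_succ); exact: rec_proj.
apply: rec_ext (recursive2_iteri recursive1_id rG) _ => v /=.
by elim: (tnth v ord0) => //= m ->.
Qed.

Lemma recursive2_mul : recursive2 muln.
Proof.
have rG : recursive3 (fun _ r e => e + r).
  by apply: (recursive2_comp recursive2_add); exact: rec_proj.
apply: rec_ext (recursive2_iteri (F := fun _ => 0) (recursive_const _ 0) rG) _ => v /=.
by elim: (tnth v ord0) => //= m ->.
Qed.

Lemma recursive1_pred : recursive1 predn.
Proof.
apply: rec_ext (recursive1_iteri 0 recursive2_fst) _ => v /=.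
by case: (thead v).
Qed.

Lemma recursive2_sub : recursive2 subn.
Proof.
have rG : recursive3 (fun _ r _ => r.-1).
  by apply: (recursive1_comp recursive1_pred); exact: rec_proj.
have rs := recursive2_iteri recursive1_id rG.
apply: rec_ext (recursive2_comp rs (recursive2_snd) (recursive2_fst)) _ => v /=.
by elim: (tnth v ord_max) => /= [|m ->]; rewrite ?subn0 ?subnS.
Qed.

Lemma recursive2_eqn : recursive2 (fun m n => m == n).
Proof.
have rd : recursive2 (fun m n => 1 - ((m - n) + (n - m))).
  apply: (recursive2_comp recursive2_sub (recursive_const _ 1)).
  apply: (recursive2_comp recursive2_add).
    exact: recursive2_sub.
  by apply: (recursive2_comp recursive2_sub); exact: rec_proj.
apply: rec_ext rd _ => v /=; move: (tnth v ord0) (tnth v ord_max) => m n.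
rewrite eqn_leq -!subn_eq0; case: (m - n) => [|i]; case: (n - m) => [|j] //=.
Qed.

Lemma recursive3_cond : recursive3 (fun b m n => if b == 0 then n else m).
Proof.
have rb : recursive3 (fun b _ _ => b == 0).
  by apply: (recursive2_comp recursive2_eqn); [exact: rec_proj | exact: recursive_const].
have rc : recursive3 (fun b m n => (b == 0) * n + (1 - (b == 0)) * m).
  apply: (recursive2_comp recursive2_add);
    apply: (recursive2_comp recursive2_mul); try exact: rec_proj; try exact: rb.
  by apply: (recursive2_comp recursive2_sub); [exact: recursive_const | exact: rb].
apply: rec_ext rc _ => v /=.
by case: eqP => _; rewrite ?mul1n ?addn0.
Qed.

Lemma recursive1_exp2 : recursive1 (expn 2).
Proof.
have rG : recursive2 (fun _ r => r + r).
  by apply: (recursive2_comp recursive2_add); exact: rec_proj.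
apply: rec_ext (recursive1_iteri 1 rG) _ => v /=.
by elim: (thead v) => //= m ->; rewrite addnn -mul2n expnS.
Qed.

Lemma recursive1_odd : recursive1 odd.
Proof.
have rG : recursive2 (fun _ r => 1 - r).
  by apply: (recursive2_comp recursive2_sub); [exact: recursive_const | exact: rec_proj].
apply: rec_ext (recursive1_iteri 0 rG) _ => v /=.
by elim: (thead v) => //= m ->; case: odd.
Qed.

Lemma recursive1_half : recursive1 half.
Proof.
have rG : recursive2 (fun k r => odd k + r).
  apply: (recursive2_comp recursive2_add); last exact: rec_proj.
  by apply: (recursive1_comp recursive1_odd); exact: rec_proj.
apply: rec_ext (recursive1_iteri 0 rG) _ => v /=.
by elim: (thead v) => //= m ->; rewrite uphalf_half.
Qed.

(** [CodeSeq.code (m :: s)] is [cons_code m (CodeSeq.code s)]. *)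
Definition cons_code (m n : nat) : nat := 2 ^ m * n.*2.+1.
(** Halving stops at the first odd value. A positive [c] exceeds the
    exponent of 2 in it, so [c] rounds are enough; the rounds that do halve count
    that exponent. *)
Definition strip_twos (k c : nat) : nat :=
  iteri k (fun _ r => if odd r then r else r./2) c.
Definition head_code (c : nat) : nat :=
  iteri c (fun k r => r + ~~ odd (strip_twos k c)) 0.
Definition behead_code (c : nat) : nat := (strip_twos c c)./2.

Lemma strip_twosE k m n :
  strip_twos k (cons_code m n) = cons_code (m - k) n.
Proof.
elim: k => [|k IH]; first by rewrite subn0.
rewrite /strip_twos /= -/(strip_twos _ _) IH /cons_code subnS.
case: (m - k) => [|j]; first by rewrite expn0 mul1n /= odd_double.
by rewrite expnS -mulnA oddM /= mul2n doubleK.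
Qed.

Lemma ltn_cons_code m n : m < cons_code m n.
Proof.
by apply: leq_trans (ltn_expl m (ltnSn 1)) _; rewrite leq_pmulr.
Qed.

Lemma head_codeE m n : head_code (cons_code m n) = m.
Proof.
rewrite /head_code.
have H k : iteri k (fun k r => r + ~~ odd (strip_twos k (cons_code m n))) 0 = minn k m.
  elim: k => [|k IH]; first by rewrite min0n.
  rewrite [LHS]/= IH strip_twosE /cons_code.
  have [lt_km|le_mk] := ltnP k m.
    rewrite -[m - k]prednK ?subn_gt0 // expnS -mulnA oddM /=.
    by rewrite (minn_idPl lt_km) addn1.
  rewrite (eqP (_ : m - k == 0)) // expn0 mul1n /= odd_double addn0.
  by rewrite (minn_idPr (leqW le_mk)).
by rewrite H; apply/minn_idPr/ltnW/ltn_cons_code.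
Qed.

Lemma behead_codeE m n : behead_code (cons_code m n) = n.
Proof.
rewrite /behead_code strip_twosE (eqP (_ : m - _ == 0)) ?subn_eq0 1?ltnW ?ltn_cons_code //.
by rewrite /cons_code expn0 mul1n /= uphalf_double.
Qed.

Lemma recursive2_cons_code : recursive2 cons_code.
Proof.
have rd : recursive1 (fun n => (n + n).+1).
  apply: (recursive1_comp recursive1_succ).
  by apply: (recursive2_comp recursive2_add); exact: rec_proj.
have rc : recursive2 (fun m n => 2 ^ m * (n + n).+1).
  apply: (recursive2_comp recursive2_mul).
    by apply: (recursive1_comp recursive1_exp2); exact: rec_proj.
  by apply: (recursive1_comp rd); exact: rec_proj.
by apply: rec_ext rc _ => v /=; rewrite addnn.
Qed.

Lemma recursive2_strip_twos : recursive2 strip_twos.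
Proof.
have rG : recursive3 (fun _ r _ => if odd r == 0 :> nat then r./2 else r).
  apply: (recursive3_comp recursive3_cond); last 2 first.
  - exact: rec_proj.
  - by apply: (recursive1_comp recursive1_half); exact: rec_proj.
  by apply: (recursive1_comp recursive1_odd); exact: rec_proj.
apply: rec_ext (recursive2_iteri recursive1_id rG) _ => v /=.
by apply: eq_iteri => _ r; case: odd.
Qed.

Lemma recursive1_head_code : recursive1 head_code.
Proof.
have rG : recursive3 (fun k r c => r + (1 - odd (strip_twos k c))).
  apply: (recursive2_comp recursive2_add); first exact: rec_proj.
  apply: (recursive2_comp recursive2_sub); first exact: recursive_const.
  apply: (recursive1_comp recursive1_odd).
  by apply: (recursive2_comp recursive2_strip_twos); exact: rec_proj.
have rh := recursive2_iteri (F := fun _ => 0) (recursive_const _ 0) rG.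
apply: rec_ext (recursive2_comp rh recursive1_id recursive1_id) _ => v /=.
by rewrite /head_code; apply: eq_iteri => k r; case: odd.
Qed.

Lemma recursive1_behead_code : recursive1 behead_code.
Proof.
apply: (recursive1_comp recursive1_half).
by apply: (recursive2_comp recursive2_strip_twos); exact: rec_proj.
Qed.

(** * Computable functions between countable types *)

Definition pair_code (m n : nat) : nat := cons_code m (cons_code n 0).

Lemma recursive2_pair_code : recursive2 pair_code.
Proof.
apply: (recursive2_comp recursive2_cons_code); first exact: rec_proj.
apply: (recursive2_comp recursive2_cons_code); first exact: rec_proj.
exact: recursive_const.
Qed.

(** Values are represented by [pickle]. Nothing is asked of the tracking function
    on numbers that are not codes, so a type needs no decidable set of codes. *)
Definition computable (T U : countType) (f : T -> U) : Prop :=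
  exists2 g, recursive1 g & forall x, g (pickle x) = pickle (f x).

Lemma eq_computable (T U : countType) (f g : T -> U) :
  computable f -> f =1 g -> computable g.
Proof. by move=> [h rh hE] fg; exists h => // x; rewrite hE fg. Qed.

Lemma computable_const (E T : countType) (c : T) : computable (fun _ : E => c).
Proof. by exists (fun _ => pickle c) => //; exact: recursive_const. Qed.

Lemma computable_id (E : countType) : computable (fun e : E => e).
Proof. by exists id => //; exact: rec_proj. Qed.

Lemma computable_comp (E T U : countType) (f : T -> U) (a : E -> T) :
  computable f -> computable a -> computable (fun e => f (a e)).
Proof.
move=> [g rg gE] [h rh hE]; exists (fun n => g (h n)); last by move=> x; rewrite hE gE.
exact: recursive1_comp rg rh.
Qed.

Lemma computable_pair (E T U : countType) (a : E -> T) (b : E -> U) :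
  computable a -> computable b -> computable (fun e => (a e, b e)).
Proof.
move=> [g rg gE] [h rh hE]; exists (fun n => pair_code (g n) (h n)).
  exact: recursive2_comp recursive2_pair_code rg rh.
by move=> x; rewrite gE hE.
Qed.

Lemma computable_comp2 (E T U V : countType) (h : T -> U -> V) (a : E -> T) (b : E -> U) :
  computable (fun x : T * U => h x.1 x.2) -> computable a -> computable b ->
  computable (fun e => h (a e) (b e)).
Proof.
move=> ch ca cb.
exact: (computable_comp (f := fun x : T * U => h x.1 x.2) ch (computable_pair ca cb)).
Qed.

Lemma computable_comp3 (E S T U V : countType) (h : S -> T -> U -> V)
    (a : E -> S) (b : E -> T) (c : E -> U) :
  computable (fun x : S * T * U => h x.1.1 x.1.2 x.2) ->
  computable a -> computable b -> computable c ->
  computable (fun e => h (a e) (b e) (c e)).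
Proof.
move=> ch ca cb cc.
exact: (computable_comp (f := fun x : S * T * U => h x.1.1 x.1.2 x.2) ch
  (computable_pair (computable_pair ca cb) cc)).
Qed.

Lemma computable_fst (E T U : countType) (a : E -> T * U) :
  computable a -> computable (fun e => (a e).1).
Proof.
apply: computable_comp; exists head_code; first exact: recursive1_head_code.
by case=> x y; exact: head_codeE.
Qed.

Lemma computable_snd (E T U : countType) (a : E -> T * U) :
  computable a -> computable (fun e => (a e).2).
Proof.
apply: computable_comp; exists (fun n => head_code (behead_code n)).
  exact: recursive1_comp recursive1_head_code recursive1_behead_code.
case=> x y; rewrite -[pickle (x, y)]/(pair_code _ _) behead_codeE.
exact: head_codeE.
Qed.

Lemma computable_eq (E T : countType) (a b : E -> T) :
  computable a -> computable b -> computable (fun e => a e == b e).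
Proof.
move=> [g rg gE] [h rh hE]; exists (fun n => g n == h n).
  exact: recursive2_comp recursive2_eqn rg rh.
by move=> x; rewrite gE hE (inj_eq (pcan_inj pickleK)).
Qed.

Lemma computable_if (E T : countType) (b : E -> bool) (x y : E -> T) :
  computable b -> computable x -> computable y ->
  computable (fun e => if b e then x e else y e).
Proof.
move=> [g rg gE] [h rh hE] [k rk kE].
exists (fun n => if g n == 0 then k n else h n).
  exact: recursive3_comp recursive3_cond rg rh rk.
by move=> e; rewrite gE hE kE; case: (b e).
Qed.

Lemma computable_and (E : countType) (a b : E -> bool) :
  computable a -> computable b -> computable (fun e => a e && b e).
Proof.
move=> ca cb; apply: eq_computable (computable_if ca cb (computable_const E false)) _.
by move=> e; case: (a e).
Qed.

Lemma computable_or (E : countType) (a b : E -> bool) :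
  computable a -> computable b -> computable (fun e => a e || b e).
Proof.
move=> ca cb; apply: eq_computable (computable_if ca (computable_const E true) cb) _.
by move=> e; case: (a e).
Qed.

Lemma computable_neg (E : countType) (a : E -> bool) :
  computable a -> computable (fun e => ~~ a e).
Proof.
move=> ca.
apply: eq_computable (computable_if ca (computable_const E false) (computable_const E true)) _.
by move=> e; case: (a e).
Qed.

Lemma computable_succ (E : countType) (a : E -> nat) :
  computable a -> computable (fun e => (a e).+1).
Proof.
by apply: computable_comp; exists succn => //; exact: recursive1_succ.
Qed.

Lemma computable_pred (E : countType) (a : E -> nat) :
  computable a -> computable (fun e => (a e).-1).
Proof.
by apply: computable_comp; exists predn => //; exact: recursive1_pred.
Qed.

Lemma computable_add (E : countType) (a b : E -> nat) :
  computable a -> computable b -> computable (fun e => a e + b e).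
Proof.
move=> [g rg gE] [h rh hE]; exists (fun n => g n + h n).
  exact: recursive2_comp recursive2_add rg rh.
by move=> x; rewrite gE hE.
Qed.

Lemma computable_iteri (E T : countType) (n : E -> nat)
    (h : E -> nat -> T -> T) (z : E -> T) :
  computable n -> computable (fun x : E * nat * T => h x.1.1 x.1.2 x.2) ->
  computable z -> computable (fun e => iteri (n e) (h e) (z e)).
Proof.
move=> [gn rn nE] [gh rh hE] [gz rz zE].
pose G k r e := gh (pair_code (pair_code e k) r).
have rG : recursive3 G.
  apply: (recursive1_comp rh); apply: (recursive2_comp recursive2_pair_code);
    last exact: rec_proj.
  by apply: (recursive2_comp recursive2_pair_code); exact: rec_proj.
exists (fun m => iteri (gn m) (fun k r => G k r m) (gz m)).
  exact: recursive2_comp (recursive2_iteri rz rG) rn recursive1_id.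
move=> e; rewrite nE zE; elim: (n e) => //= k ->.
by rewrite /G -(hE (e, k, _)).
Qed.

Lemma computable_iter (E T : countType) (n : E -> nat)
    (h : E -> T -> T) (z : E -> T) :
  computable n -> computable (fun x : E * T => h x.1 x.2) ->
  computable z -> computable (fun e => iter (n e) (h e) (z e)).
Proof.
move=> cn ch cz.
have ch' : computable (fun x : E * nat * T => h x.1.1 x.2).
  apply: (computable_comp2 ch); last exact/computable_snd/computable_id.
  exact/computable_fst/computable_fst/computable_id.
apply: eq_computable (computable_iteri (h := fun e _ => h e) cn ch' cz) _ => e.
by elim: (n e) => //= k ->.
Qed.

Lemma computable_cons (E T : countType) (a : E -> T) (s : E -> seq T) :
  computable a -> computable s -> computable (fun e => a e :: s e).
Proof.
move=> [g rg gE] [h rh hE]; exists (fun n => cons_code (g n) (h n)).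
  exact: recursive2_comp recursive2_cons_code rg rh.
by move=> x; rewrite gE hE.
Qed.

Lemma computable_case_seq (E T U : countType) (s : E -> seq T)
    (z : E -> U) (h : E -> T -> seq T -> U) :
  computable s -> computable z ->
  computable (fun x : E * T * seq T => h x.1.1 x.1.2 x.2) ->
  computable (fun e => if s e is a :: s' then h e a s' else z e).
Proof.
move=> [gs rs sE] [gz rz zE] [gh rh hE].
pose k n := gh (pair_code (pair_code n (head_code (gs n))) (behead_code (gs n))).
have rk : recursive1 k.
  apply: (recursive1_comp rh); apply: (recursive2_comp recursive2_pair_code);
    last exact: (recursive1_comp recursive1_behead_code).
  apply: (recursive2_comp recursive2_pair_code); first exact: rec_proj.
  exact: (recursive1_comp recursive1_head_code).
exists (fun n => if gs n == 0 then gz n else k n).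
  exact: recursive3_comp recursive3_cond rs rk rz.
move=> e; rewrite /k sE zE; case: (s e) => [|a s'] //.
rewrite -[pickle (a :: s')]/(cons_code (pickle a) (pickle s')) head_codeE behead_codeE.
by rewrite gtn_eqF ?(leq_ltn_trans _ (ltn_cons_code _ _)) // -(hE (e, a, s')).
Qed.

(** The fold is an iteration on pairs of an accumulator and the rest of the list.
    The number of rounds has to be known in advance: the code of a list exceeds
    its length, and rounds on an empty rest change nothing. *)
Lemma computable_foldl (E T A : countType) (h : E -> A -> T -> A)
    (z : E -> A) (s : E -> seq T) :
  computable (fun x : E * A * T => h x.1.1 x.1.2 x.2) ->
  computable z -> computable s -> computable (fun e => foldl (h e) (z e) (s e)).
Proof.
move=> ch cz cs.
have [gs rs sE] := cs.
pose step e (y : A * seq T) : A * seq T :=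
  if y.2 is a :: s' then (h e y.1 a, s') else y.
have cstep : computable (fun x : E * (A * seq T) => step x.1 x.2).
  apply: (computable_case_seq (s := fun x : E * (A * seq T) => x.2.2)
    (z := fun x => x.2) (h := fun x a s' => (h x.1 x.2.1 a, s'))).
  - exact/computable_snd/computable_snd/computable_id.
  - exact/computable_snd/computable_id.
  apply: computable_pair; last exact/computable_snd/computable_id.
  apply: (computable_comp3 ch); last exact/computable_snd/computable_fst/computable_id.
    exact/computable_fst/computable_fst/computable_fst/computable_id.
  exact/computable_fst/computable_snd/computable_fst/computable_fst/computable_id.
have cn : computable (fun e => pickle (s e)) by exists gs.
apply: eq_computable (computable_fst (computable_iter cn cstep (computable_pair cz cs))) _.
move=> e.
have : size (s e) <= pickle (s e).
  elim: (s e) => //= a s' IH; apply: leq_ltn_trans IH _.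
  rewrite -[pickle (a :: s')]/(cons_code (pickle a) (pickle s')).
  by apply: leq_trans (leq_pmull _ _); rewrite ?expn_gt0 // ltnS -addnn leq_addl.
move: (pickle (s e)) => k; elim: k (s e) (z e) => [|k IH] [|a s'] y lt_k //.
  by rewrite iterSr /= -[RHS]/(foldl (h e) y [::]) -IH.
by rewrite iterSr /= IH.
Qed.

Lemma computable_rev (E T : countType) (s : E -> seq T) :
  computable s -> computable (fun e => rev (s e)).
Proof.
apply: computable_comp.
have c : computable (fun s : seq T => foldl (fun r a => a :: r) [::] s).
  apply: (computable_foldl (h := fun _ r a => a :: r)); last exact: computable_id.
    apply: computable_cons; first exact/computable_snd/computable_id.
    exact/computable_snd/computable_fst/computable_id.
  exact: computable_const.
apply: eq_computable c _ => {}s.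
by rewrite -[s in LHS]revK foldl_rev; elim: (rev s) => //= a r ->.
Qed.

Lemma computable_foldr (E T A : countType) (h : E -> T -> A -> A)
    (z : E -> A) (s : E -> seq T) :
  computable (fun x : E * T * A => h x.1.1 x.1.2 x.2) ->
  computable z -> computable s -> computable (fun e => foldr (h e) (z e) (s e)).
Proof.
move=> ch cz cs.
have c : computable (fun e => foldl (fun y a => h e a y) (z e) (rev (s e))).
  apply: (computable_foldl (h := fun e y a => h e a y)) cz (computable_rev cs).
  apply: (computable_comp3 ch); last exact/computable_snd/computable_fst/computable_id.
    exact/computable_fst/computable_fst/computable_id.
  exact/computable_snd/computable_id.
by apply: eq_computable c _ => e; rewrite foldl_rev.
Qed.

Lemma computable_cat (E T : countType) (s1 s2 : E -> seq T) :
  computable s1 -> computable s2 -> computable (fun e => s1 e ++ s2 e).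
Proof.
move=> c1 c2.
have c : computable (fun e => foldr (fun a r => a :: r) (s2 e) (s1 e)).
  apply: (computable_foldr (h := fun _ a r => a :: r)) c2 c1.
  apply: computable_cons; last exact/computable_snd/computable_id.
  exact/computable_snd/computable_fst/computable_id.
by apply: eq_computable c _ => e; elim: (s1 e) => //= a r ->.
Qed.

Lemma computable_map (E T U : countType) (f : E -> T -> U) (s : E -> seq T) :
  computable (fun x : E * T => f x.1 x.2) -> computable s ->
  computable (fun e => [seq f e a | a <- s e]).
Proof.
move=> cf cs.
have c : computable (fun e => foldr (fun a r => f e a :: r) [::] (s e)).
  apply: (computable_foldr (h := fun e a r => f e a :: r)) (computable_const _ _) cs.
  apply: computable_cons; last exact/computable_snd/computable_id.
  exact: computable_comp cf (computable_fst (computable_id _)).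
by apply: eq_computable c _ => e; elim: (s e) => //= a r ->.
Qed.

Lemma computable_flatten (E T : countType) (s : E -> seq (seq T)) :
  computable s -> computable (fun e => flatten (s e)).
Proof.
move=> cs.
apply: (computable_foldr (h := fun _ a r => a ++ r)) (computable_const _ _) cs.
apply: computable_cat; last exact/computable_snd/computable_id.
exact/computable_snd/computable_fst/computable_id.
Qed.

Lemma computable_filter (E T : countType) (p : E -> T -> bool) (s : E -> seq T) :
  computable (fun x : E * T => p x.1 x.2) -> computable s ->
  computable (fun e => [seq a <- s e | p e a]).
Proof.
move=> cp cs.
have c : computable (fun e => foldr (fun a r => if p e a then a :: r else r) [::] (s e)).
  apply: (computable_foldr (h := fun e a r => if p e a then a :: r else r))
    (computable_const _ _) cs.
  apply: computable_if.
  - exact: computable_comp cp (computable_fst (computable_id _)).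
  - apply: computable_cons; last exact/computable_snd/computable_id.
    exact/computable_snd/computable_fst/computable_id.
  exact/computable_snd/computable_id.
by apply: eq_computable c _ => e; elim: (s e) => //= a r ->.
Qed.

Lemma computable_has (E T : countType) (p : E -> T -> bool) (s : E -> seq T) :
  computable (fun x : E * T => p x.1 x.2) -> computable s ->
  computable (fun e => has (p e) (s e)).
Proof.
move=> cp cs.
have c := computable_eq (computable_filter cp cs) (computable_const _ [::]).
apply: eq_computable (computable_neg c) _ => e.
by rewrite has_filter.
Qed.

Lemma computable_mem (E T : countType) (a : E -> T) (s : E -> seq T) :
  computable a -> computable s -> computable (fun e => a e \in s e).
Proof.
move=> ca cs.
have c : computable (fun e => has (fun b => b == a e) (s e)).
  apply: (computable_has (p := fun e b => b == a e)) cs.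
  apply: computable_eq; first exact/computable_snd/computable_id.
  by apply: computable_comp ca _; exact/computable_fst/computable_id.
by apply: eq_computable c _ => e; rewrite has_pred1.
Qed.

Lemma computable_size (E T : countType) (s : E -> seq T) :
  computable s -> computable (fun e => size (s e)).
Proof.
move=> cs.
have c : computable (fun e => foldr (fun _ n => n.+1) 0 (s e)).
  apply: (computable_foldr (h := fun _ _ n => n.+1)) (computable_const _ _) cs.
  exact/computable_succ/computable_snd/computable_id.
by apply: eq_computable c _ => e; elim: (s e) => //= a r ->.
Qed.

Lemma computable_iota (E : countType) (n : E -> nat) :
  computable n -> computable (fun e => iota 0 (n e)).
Proof.
move=> cn.
have c : computable (fun e => iteri (n e) (fun k r => r ++ [:: k]) [::]).
  apply: (computable_iteri (h := fun _ k r => r ++ [:: k])) cn _ (computable_const _ _).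
  apply: computable_cat; first exact/computable_snd/computable_id.
  apply: computable_cons; last exact: computable_const.
  exact/computable_snd/computable_fst/computable_id.
apply: eq_computable c _ => e; elim: (n e) => //= k ->.
by rewrite -[X in _ = X]/(iota 0 k.+1) -addn1 iotaD.
Qed.

Lemma computable_nth (E T : countType) (d : T) (s : E -> seq T) (n : E -> nat) :
  computable s -> computable n -> computable (fun e => nth d (s e) (n e)).
Proof.
move=> cs cn.
have cb : computable (fun e => iter (n e) behead (s e)).
  apply: (computable_iter (h := fun _ => behead)) cn _ cs.
  have := computable_case_seq (h := fun _ _ r => r)
    (computable_snd (computable_id (E * seq T)%type)) (computable_const _ [::])
    (computable_snd (computable_id _)).
  by move/eq_computable; apply; case=> e [].
have c : computable (fun e => if iter (n e) behead (s e) is a :: _ then a else d).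
  apply: (computable_case_seq (h := fun _ a _ => a)) cb (computable_const _ _) _.
  exact/computable_snd/computable_fst/computable_id.
apply: eq_computable c _ => e.
elim: (n e) (s e) => [|k IH] [|a r] //; rewrite iterSr ?IH //=.
by rewrite nth_nil.
Qed.

(** A function on a finite type is a table. *)
Lemma computable_fin (A : finType) (U : countType) (f : A -> U) : computable f.
Proof.
have [a0 _|A0] := pickP (@predT A); last first.
  by exists id; [exact: rec_proj | move=> a; have := A0 a].
pose tab := [seq (a, f a) | a : A].
have c : computable (fun a =>
    if [seq y <- tab | y.1 == a] is y :: _ then y.2 else f a0).
  apply: (computable_case_seq (h := fun _ (y : A * U) _ => y.2)).
  - apply: (computable_filter (p := fun a (y : A * U) => y.1 == a)) (computable_const _ _).
    apply: computable_eq; last exact/computable_fst/computable_id.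
    exact/computable_fst/computable_snd/computable_id.
  - exact: computable_const.
  exact/computable_snd/computable_snd/computable_fst/computable_id.
apply: eq_computable c _ => a.
case Ef: [seq y <- tab | y.1 == a] => [|y r].
  have : (a, f a) \in [seq y <- tab | y.1 == a].
    by rewrite mem_filter eqxx; apply: image_f.
  by rewrite Ef.
have : y \in [seq y <- tab | y.1 == a] by rewrite Ef mem_head.
by rewrite mem_filter => /andP[/eqP <- /imageP[b _ ->]].
Qed.

Definition int_succ (i : int) : int :=
  match i with Posz n => Posz n.+1 | Negz 0 => Posz 0 | Negz n.+1 => Negz n end.
Definition int_pred (i : int) : int :=
  match i with Posz 0 => Negz 0 | Posz n.+1 => Posz n | Negz n => Negz n.+1 end.

Lemma int_succE i : int_succ i = (i + 1)%R.
Proof.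
case: i => [n|[|n]]; first by rewrite /= -addn1 PoszD.
  by rewrite NegzE addNr.
by rewrite /= !NegzE -[in RHS]addn1 PoszD opprD addrNK.
Qed.

Lemma int_predE i : int_pred i = (i - 1)%R.
Proof. by apply/esym/eqP; rewrite subr_eq -int_succE; case: i => [[|n]|n]. Qed.

Lemma computable_int_case (E U : countType) (i : E -> int) (f g : E -> nat -> U) :
  computable i ->
  computable (fun x : E * nat => f x.1 x.2) ->
  computable (fun x : E * nat => g x.1 x.2) ->
  computable (fun e => match i e with Posz n => f e n | Negz n => g e n end).
Proof.
move=> ci cf cg.
(* [pickle] gives an integer and its image under [parts] the same code. *)
pose parts (j : int) : seq nat * seq nat :=
  match j with Posz n => ([:: n], [::]) | Negz n => ([::], [:: n]) end.
have cp : computable parts by exists id; [exact: rec_proj | case].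
have cpi := computable_comp cp ci.
pose hd (s : seq nat) := nth 0 s 0.
have chd (E' : countType) (s : E' -> seq nat) : computable s -> computable (fun e => hd (s e)).
  by move=> cs; apply: computable_nth cs (computable_const _ _).
have c : computable (fun e => if (parts (i e)).1 == [::]
    then g e (hd (parts (i e)).2) else f e (hd (parts (i e)).1)).
  apply: computable_if.
  - exact: (computable_eq (computable_fst cpi) (computable_const _ _)).
  - apply: (computable_comp2 cg (computable_id _)).
    exact/chd/computable_snd.
  apply: (computable_comp2 cf (computable_id _)).
  exact/chd/computable_fst.
by apply: eq_computable c _ => e; case: (i e).
Qed.

Lemma computable_Posz (E : countType) (n : E -> nat) :
  computable n -> computable (fun e => Posz (n e)).
Proof.
apply: computable_comp.
have [g rg gE] : computable (fun n : nat => ([:: n], [::] : seq nat)).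
  apply: computable_pair; last exact: computable_const.
  exact: computable_cons (computable_id _) (computable_const _ _).
by exists g => // {}n; rewrite gE.
Qed.

Lemma computable_Negz (E : countType) (n : E -> nat) :
  computable n -> computable (fun e => Negz (n e)).
Proof.
apply: computable_comp.
have [g rg gE] : computable (fun n : nat => ([::] : seq nat, [:: n])).
  apply: computable_pair; first exact: computable_const.
  exact: computable_cons (computable_id _) (computable_const _ _).
by exists g => // {}n; rewrite gE.
Qed.

Lemma computable_int_succ (E : countType) (i : E -> int) :
  computable i -> computable (fun e => int_succ (i e)).
Proof.
move=> ci.
have c : computable (fun e => match i e with
    | Posz n => Posz n.+1
    | Negz n => if n == 0 then Posz 0 else Negz n.-1 end).
  apply: (computable_int_case (f := fun _ n => Posz n.+1)
    (g := fun _ n => if n == 0 then Posz 0 else Negz n.-1)) ci _ _.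
    exact/computable_Posz/computable_succ/computable_snd/computable_id.
  apply: computable_if; last exact/computable_Negz/computable_pred/computable_snd/computable_id.
    exact: computable_eq (computable_snd (computable_id _)) (computable_const _ _).
  exact: computable_const.
by apply: eq_computable c _ => e; case: (i e) => [n|[|n]].
Qed.

Lemma computable_int_pred (E : countType) (i : E -> int) :
  computable i -> computable (fun e => int_pred (i e)).
Proof.
move=> ci.
have c : computable (fun e => match i e with
    | Posz n => if n == 0 then Negz 0 else Posz n.-1
    | Negz n => Negz n.+1 end).
  apply: (computable_int_case (g := fun _ n => Negz n.+1)
    (f := fun _ n => if n == 0 then Negz 0 else Posz n.-1)) ci _ _; last first.
    exact/computable_Negz/computable_succ/computable_snd/computable_id.
  apply: computable_if; last exact/computable_Posz/computable_pred/computable_snd/computable_id.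
    exact: computable_eq (computable_snd (computable_id _)) (computable_const _ _).
  exact: computable_const.
by apply: eq_computable c _ => e; case: (i e) => [[|n]|n].
Qed.

(** * Free reduction *)

Section FreeReduction.
Variable X : choiceType.
Implicit Types (l : X * bool) (u v z : word X).

Definition free_eq : word X -> word X -> Prop := pres_eq (fun _ => False).

Definition letter_inv l : X * bool := (l.1, ~~ l.2).

Lemma letter_invK : involutive letter_inv.
Proof. by case=> x e; rewrite /letter_inv negbK. Qed.

Definition reduce_cons l z : word X :=
  if z is l' :: z' then if l' == letter_inv l then z' else l :: z else [:: l].

Definition reduce u : word X := foldr reduce_cons [::] u.

Definition reduced z : bool := sorted (fun l l' => l' != letter_inv l) z.

Lemma reduced_cons l z : reduced z -> reduced (reduce_cons l z).
Proof.
case: z => [|l' z] //= z_red; case: ifPn => [_|nl] /=; last by rewrite nl.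
exact: path_sorted z_red.
Qed.

Lemma reduced_reduce u : reduced (reduce u).
Proof. by elim: u => //= l u; exact: reduced_cons. Qed.

(** In a reduced word the letter behind a leading [l] is not the inverse of [l], so
    cancelling the leading letter and putting it back causes no cancellation. *)
Lemma reduce_consK l z : reduced z -> reduce_cons l (reduce_cons (letter_inv l) z) = z.
Proof.
case: z => [|l' z]; first by rewrite /= eqxx.
rewrite {2}/reduce_cons letter_invK; case: eqP => [-> |_] /= z_red; last by rewrite eqxx.
by case: z z_red => [|l2 z] //= /andP[/negPf -> _].
Qed.

Lemma free_eq_reduce u : free_eq (reduce u) u.
Proof.
elim: u => [|l u IH]; first exact: pres_refl.
apply: pres_trans (pres_eq_catl [:: l] IH) => /=.
case: (reduce u) => [|l' z] /=; first exact: pres_refl.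
case: eqP => [->|_]; last exact: pres_refl.
by apply: pres_sym; case: l => x e; exact: (pres_cancel _ [::]).
Qed.

Lemma reduceP u v : free_eq u v <-> reduce u = reduce v.
Proof.
split; last first.
  move=> uv; apply: pres_trans (free_eq_reduce v); rewrite -uv.
  exact/pres_sym/free_eq_reduce.
elim=> // [u1 u2 u3 _ -> _ -> //|u1 u2 x e].
rewrite /reduce !foldr_cat /=; congr foldr.
exact: (reduce_consK (x, e) (reduced_reduce u2)).
Qed.

End FreeReduction.

(** * Rational subsets of free groups *)

Section MonotoneIteration.
Variables (T : eqType) (U : seq T) (good : seq T -> pred T).
Hypothesis good_mono : forall E E' x, {subset E <= E'} -> good E x -> good E' x.

Definition grow (E : seq T) : seq T := [seq x <- U | good E x].

(** The iterates form an increasing chain of subsequences of [U]; as long as the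
    chain moves its lengths increase, which can happen at most [size U] times. *)
Lemma iter_grow_fixed : grow (iter (size U).+1 grow [::]) = iter (size U).+1 grow [::].
Proof.
have subS k : {subset iter k grow [::] <= iter k.+1 grow [::]}.
  elim: k => [|k IH] x //=.
  rewrite [in X in X -> _]mem_filter mem_filter => /andP[gx ->]; rewrite andbT.
  by apply: good_mono gx.
have H k : grow (iter k grow [::]) = iter k grow [::] \/ k <= size (iter k grow [::]).
  elim: k => [|k [IH|IH]]; [by right | by left; rewrite /= IH | ].
  have: subseq (iter k grow [::]) (iter k.+1 grow [::]).
    case: k subS {IH} => [|k] subS; first exact: sub0seq.
    rewrite /= [in X in subseq X _]/grow.
    have -> : [seq x <- U | good (iter k grow [::]) x] =
        [seq x <- grow (grow (iter k grow [::])) | good (iter k grow [::]) x].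
      rewrite [in RHS]/grow -filter_predI; apply: eq_in_filter => x _ /=.
      by apply/esym/andb_idr => gx; apply: good_mono gx; apply: subS.
    exact: filter_subseq.
  move/size_subseq_leqif => le_sz.
  have [eq_it|ne_it] := eqVneq (iter k.+1 grow [::]) (iter k grow [::]).
    by left; rewrite eq_it.
  right; apply: leq_ltn_trans IH _; rewrite (ltn_leqif le_sz).
  by rewrite eq_sym.
have [//|] := H (size U).+1.
by rewrite leqNgt ltnS (leq_trans (size_subseq (filter_subseq _ _))).
Qed.

End MonotoneIteration.

Section Automaton.
Variables (X : choiceType) (Q : eqType).
Variables (delta : seq (Q * (X * bool) * Q)) (eps : seq (Q * Q)) (S : seq Q).
Implicit Types (p q r : Q) (u v z : word X).

Inductive nfa_path : Q -> word X -> Q -> Prop :=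
| nfa_path_nil p : nfa_path p [::] p
| nfa_path_eps p q r u : (p, q) \in eps -> nfa_path q u r -> nfa_path p u r
| nfa_path_cons p l q r u :
    (p, l, q) \in delta -> nfa_path q u r -> nfa_path p (l :: u) r.

Lemma nfa_path_cat p u q v r : nfa_path p u q -> nfa_path q v r -> nfa_path p (u ++ v) r.
Proof.
elim=> // {p u q} [p q s u pq _ IH|p l q s u pq _ IH] /IH.
  exact: nfa_path_eps.
exact: nfa_path_cons.
Qed.

(** One round of saturation. The last clause cancels a letter against its inverse
    across a trivial path found earlier; the others make the relation a preorder
    that contains the silent moves. *)
Definition trivial_step (E : seq (Q * Q)) (pr : Q * Q) : bool :=
  [|| pr.1 == pr.2, pr \in eps,
      has (fun a => ((pr.1, a) \in E) && ((a, pr.2) \in E)) S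
    | has (fun d => (d.1.1 == pr.1) && has (fun d' =>
        [&& d'.2 == pr.2, d'.1.2 == letter_inv d.1.2 & (d.2, d'.1.1) \in E]) delta) delta].

(** The pairs of states joined by a path whose label is freely trivial. *)
Definition trivial_pairs : seq (Q * Q) :=
  let U := [seq (p, r) | p <- S, r <- S] in
  iter (size U).+1 (grow U trivial_step) [::].

(** The states from which [z] can be read, ending in [r], when every letter may be
    preceded by a trivial pair and the last one followed by one. *)
Definition accepting (r : Q) (z : word X) : seq Q :=
  foldr (fun l T => [seq p <- S | has (fun d =>
      [&& (p, d.1.1) \in trivial_pairs, d.1.2 == l & d.2 \in T]) delta])
    [seq p <- S | (p, r) \in trivial_pairs] z.

Hypothesis delta_S : forall d, d \in delta -> (d.1.1 \in S) && (d.2 \in S).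
Hypothesis eps_S : forall d, d \in eps -> (d.1 \in S) && (d.2 \in S).

Lemma trivial_pairsP p r :
  (p, r) \in trivial_pairs =
  [&& p \in S, r \in S & trivial_step trivial_pairs (p, r)].
Proof.
rewrite /trivial_pairs; set U := (X in size X); set E := iter _ _ _.
have -> : ((p, r) \in E) = ((p, r) \in grow U trivial_step E).
  rewrite iter_grow_fixed // => E1 E2 x sub; rewrite /trivial_step.
  case/or4P=> [->|->|/hasP[a aS /andP[/sub pa /sub ar]]|/hasP[d dD]]; rewrite ?orbT //.
    by apply/or4P; apply: Or43; apply/hasP; exists a; rewrite ?pa.
  move=> /andP[dp /hasP[d' d'D /and3P[d'r d'd /sub dd']]].
  apply/or4P; apply: Or44; apply/hasP; exists d; rewrite ?dp //=.
  by apply/hasP; exists d'; rewrite ?d'r ?d'd.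
rewrite mem_filter andbC andbA; congr (_ && _).
by apply/allpairsP/andP => [[[a b] /= [? ? [-> ->]]]|[]] //; exists (p, r).
Qed.

Lemma trivial_pairs_refl p : p \in S -> (p, p) \in trivial_pairs.
Proof. by move=> pS; rewrite trivial_pairsP pS /trivial_step /= eqxx. Qed.

Lemma trivial_pairs_eps p r : (p, r) \in eps -> (p, r) \in trivial_pairs.
Proof.
move=> pr; have /andP[/= pS rS] := eps_S pr.
by rewrite trivial_pairsP pS rS /trivial_step pr orbT.
Qed.

Lemma trivial_pairs_trans q p r :
  (p, q) \in trivial_pairs -> (q, r) \in trivial_pairs -> (p, r) \in trivial_pairs.
Proof.
move=> pq qr; have := pq; rewrite trivial_pairsP => /and3P[pS qS _].
have := qr; rewrite trivial_pairsP => /and3P[_ rS _].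
rewrite trivial_pairsP pS rS /=; apply/or4P; apply: Or43.
by apply/hasP; exists q => //=; rewrite pq.
Qed.

Lemma trivial_pairs_cancel p l q q' r :
  (p, l, q) \in delta -> (q, q') \in trivial_pairs ->
  (q', letter_inv l, r) \in delta -> (p, r) \in trivial_pairs.
Proof.
move=> d qq' d'; have /andP[/= pS _] := delta_S d; have /andP[/= _ rS] := delta_S d'.
rewrite trivial_pairsP pS rS /=; apply/or4P; apply: Or44.
apply/hasP; exists (p, l, q) => //=; rewrite eqxx.
by apply/hasP; exists (q', letter_inv l, r) => //=; rewrite !eqxx.
Qed.

Lemma trivial_pairs_path p r :
  (p, r) \in trivial_pairs -> exists2 v, nfa_path p v r & free_eq v [::].
Proof.
rewrite /trivial_pairs; set U := (X in size X); move: (size U).+1 => k.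
elim: k p r => //= k IH p r; rewrite mem_filter => /andP[+ _].
case/or4P=> /=.
- move/eqP <-; exists [::]; [exact: nfa_path_nil | exact: pres_refl].
- move=> pr; exists [::]; last exact: pres_refl.
  exact: nfa_path_eps pr (nfa_path_nil r).
- case/hasP=> a _ /andP[/IH[u pu u1] /IH[v rv v1]].
  exists (u ++ v); first exact: nfa_path_cat pu rv.
  exact: pres_eq_cat u1 v1.
case/hasP=> [[[p' l] q]] d /= /andP[/eqP def_p].
case/hasP=> [[[q' l'] r']] d' /= /and3P[/eqP def_r /eqP def_l /IH[u qu u1]].
subst p' r' l'; exists (l :: u ++ [:: letter_inv l]).
  apply: nfa_path_cons d _; apply: nfa_path_cat qu _.
  exact: nfa_path_cons d' (nfa_path_nil r).
apply: pres_trans (pres_eq_cat (pres_refl _ [:: l]) (pres_eq_catr [:: letter_inv l] u1)) _.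
by case: l {d d'} => x e; exact: (pres_cancel _ [::] [::]).
Qed.

Lemma accepting_nil p r : (p \in accepting r [::]) = (p \in S) && ((p, r) \in trivial_pairs).
Proof. by rewrite mem_filter andbC. Qed.

Lemma accepting_consP p r l z :
  reflect (exists q q', [/\ (p, q) \in trivial_pairs, (q, l, q') \in delta & q' \in accepting r z])
    (p \in accepting r (l :: z)).
Proof.
rewrite mem_filter; apply: (iffP andP) => [[/hasP[[[q l'] q'] d /= /and3P[pq /eqP <- q'r]] _]|].
  by exists q, q'.
case=> q [q' [pq d q'r]]; split; last first.
  by move: pq; rewrite trivial_pairsP => /and3P[].
by apply/hasP; exists (q, l, q') => //=; rewrite pq eqxx.
Qed.

Lemma accepting_trans p q r z :
  (p, q) \in trivial_pairs -> q \in accepting r z -> p \in accepting r z.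
Proof.
move=> pq; case: z => [|l z].
  rewrite !accepting_nil => /andP[_ qr]; rewrite (trivial_pairs_trans pq qr) andbT.
  by move: pq; rewrite trivial_pairsP => /and3P[].
case/accepting_consP=> q1 [q2 [/(trivial_pairs_trans pq) pq1 d q2r]].
by apply/accepting_consP; exists q1, q2.
Qed.

(** The step for which the automaton is saturated: when [l] cancels the first letter
    of [z], the two edges enclose a trivial path and merge into a trivial pair. *)
Lemma accepting_reduce_cons p l q r z :
  (p, l, q) \in delta -> q \in accepting r z -> p \in accepting r (reduce_cons l z).
Proof.
move=> d; have /andP[/= pS _] := delta_S d.
have step z' : q \in accepting r z' -> p \in accepting r (l :: z').
  by move=> qr; apply/accepting_consP; exists p, q; rewrite trivial_pairs_refl.
rewrite /reduce_cons; case: z => [|l' z]; first exact: step.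
case: eqP => [->|_]; last exact: step.
case/accepting_consP=> q1 [q2 [qq1 d' q2r]].
exact: accepting_trans (trivial_pairs_cancel d qq1 d') q2r.
Qed.

Lemma accepting_path p u r : nfa_path p u r -> r \in S -> p \in accepting r (reduce u).
Proof.
elim=> {p u r} [p pS|p q r u pq _ IH rS|p l q r u d _ IH rS].
- by rewrite accepting_nil pS trivial_pairs_refl.
- exact: accepting_trans (trivial_pairs_eps pq) (IH rS).
exact: accepting_reduce_cons d (IH rS).
Qed.

Lemma path_accepting p r z :
  p \in accepting r z -> exists2 v, nfa_path p v r & free_eq v z.
Proof.
elim: z p => [|l z IH] p.
  by rewrite accepting_nil => /andP[_ /trivial_pairs_path].
case/accepting_consP=> q [q' [/trivial_pairs_path[u pu u1] d /IH[v q'v vz]]].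
exists (u ++ l :: v); first exact: nfa_path_cat pu (nfa_path_cons d q'v).
exact: (pres_eq_cat u1 (pres_eq_catl [:: l] vz)).
Qed.

(** Benois' theorem. A path with any label turns, one letter at a time, into a
    reading of the reduced label, and the reduced word depends only on the element
    of the free group. *)
Theorem acceptingP p r z : r \in S ->
  p \in accepting r (reduce z) <-> exists2 v, nfa_path p v r & free_eq v z.
Proof.
move=> rS; split=> [/path_accepting[v pv vz]|[v pv /reduceP <-]].
  by exists v => //; exact: pres_trans vz (free_eq_reduce z).
exact: accepting_path pv rS.
Qed.

End Automaton.

(** * Words in groups and substitutions *)

Lemma word_inv_cat (X : choiceType) (u v : word X) :
  word_inv (u ++ v) = word_inv v ++ word_inv u.
Proof. by rewrite /word_inv map_cat rev_cat. Qed.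

Lemma word_inv_cons (X : choiceType) (x : X) (e : bool) (u : word X) :
  word_inv ((x, e) :: u) = word_inv u ++ [:: (x, ~~ e)].
Proof. by rewrite /word_inv /= rev_cons cats1. Qed.

Section WordEval.
Variables (X : choiceType) (H : groupType) (h : X -> H).
Implicit Types u v : word X.

Lemma word_eval_nil : word_eval h [::] = 1%g.
Proof. exact: big_nil. Qed.

Lemma word_eval_cons x e u :
  word_eval h ((x, e) :: u) = ((if e then h x else (h x)^-1) * word_eval h u)%g.
Proof. exact: big_cons. Qed.

Lemma word_eval1 x : word_eval h [:: (x, true)] = h x.
Proof. by rewrite word_eval_cons word_eval_nil mulg1. Qed.

Lemma word_eval_cat u v : word_eval h (u ++ v) = (word_eval h u * word_eval h v)%g.
Proof. exact: big_cat. Qed.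

Lemma word_eval_inv u : word_eval h (word_inv u) = (word_eval h u)^-1%g.
Proof.
elim: u => [|[x e] u IH]; first by rewrite word_eval_nil invg1.
rewrite word_inv_cons word_eval_cat IH !word_eval_cons word_eval_nil mulg1.
by rewrite invgM; case: e; rewrite //= invgK.
Qed.

Lemma word_eval_pres_eq (R : word X -> Prop) u v :
  (forall r, R r -> word_eval h r = 1%g) ->
  pres_eq R u v -> word_eval h u = word_eval h v.
Proof.
move=> Rh; elim=> // [u1 u2 z _ -> _ -> //|u1 u2 x e|u1 u2 r Rr].
  rewrite !word_eval_cat !word_eval_cons; congr (_ * _)%g.
  by case: e; rewrite /= ?mulKg ?mulVKg.
by rewrite !word_eval_cat (Rh _ Rr) mul1g.
Qed.

End WordEval.

Lemma eq_in_word_eval (X : eqType) (H : groupType) (h1 h2 : X -> H) (u : word X) :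
  (forall a, appears a u -> h1 a = h2 a) -> word_eval h1 u = word_eval h2 u.
Proof.
elim: u => [|[x e] u IH] eqh; first by rewrite /word_eval !big_nil.
rewrite /word_eval !big_cons /= eqh; last by rewrite /appears /occurrences /= eqxx.
congr (_ * _)%g; apply: IH => a a_u; apply: eqh.
by rewrite /appears /occurrences /= addn_gt0 orbC; apply/orP; left.
Qed.

Lemma word_eval_conj (X : choiceType) (H : groupType) (h : X -> H) (c : H) (u : word X) :
  word_eval (fun a => c * h a * c^-1)%g u = (c * word_eval h u * c^-1)%g.
Proof.
elim: u => [|[x e] u IH]; first by rewrite !word_eval_nil mulg1 mulgV.
rewrite !word_eval_cons IH; case: e; rewrite ?invgM ?invgK -!mulgA mulKg //.
Qed.

Section Substitution.
Variables (X Y : choiceType).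
Implicit Types (f : X -> word Y) (u v : word X).

Definition substitute f u : word Y :=
  flatten [seq (if l.2 then f l.1 else word_inv (f l.1)) | l <- u].

Lemma substitute_cat f u v : substitute f (u ++ v) = substitute f u ++ substitute f v.
Proof. by rewrite /substitute map_cat flatten_cat. Qed.

Lemma substitute_inv f u : substitute f (word_inv u) = word_inv (substitute f u).
Proof.
elim: u => [|[x e] u IH] //.
rewrite word_inv_cons substitute_cat IH.
rewrite -[substitute f ((x, e) :: u)]/((if e then f x else word_inv (f x)) ++ substitute f u).
by rewrite word_inv_cat; case: e; rewrite /substitute /= cats0 ?word_invK.
Qed.

Lemma word_eval_substitute (H : groupType) (h : Y -> H) f u :
  word_eval h (substitute f u) = word_eval (fun x => word_eval h (f x)) u.
Proof.
elim: u => [|[x e] u IH]; first by rewrite !word_eval_nil.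
rewrite word_eval_cons -IH /substitute /= word_eval_cat.
by case: e => //=; rewrite word_eval_inv.
Qed.

Definition free_group (Z : choiceType) : groupType := presented_group (fun _ : word Z => False).
Definition free_class (Z : choiceType) (u : word Z) : free_group Z :=
  class_of (fun _ => False) u.

Lemma free_eqP (Z : choiceType) (u v : word Z) : free_eq u v <-> free_class u = free_class v.
Proof. by split=> /class_ofP. Qed.

Lemma free_class_eval (Z : choiceType) (u : word Z) :
  free_class u = word_eval (fun a => free_class [:: (a, true)]) u.
Proof. exact/esym/word_eval_pres_gen. Qed.

Lemma free_class_substitute f u :
  free_class (substitute f u) = word_eval (fun x => free_class (f x)) u.
Proof.
rewrite free_class_eval word_eval_substitute; apply: eq_in_word_eval => a _.
by rewrite -free_class_eval.
Qed.

Lemma free_eq_substitute f u v :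
  free_eq u v -> free_eq (substitute f u) (substitute f v).
Proof.
move=> uv; apply/free_eqP; rewrite !free_class_substitute.
exact: word_eval_pres_eq uv.
Qed.

End Substitution.

(** * Solving a relator for a letter *)

Lemma appears_once_split (X : eqType) (a : X) (u : word X) :
  appears_once a u -> exists u1 e u2,
    [/\ u = u1 ++ (a, e) :: u2, occurrences a u1 = 0 & occurrences a u2 = 0].
Proof.
rewrite /appears_once /occurrences; elim: u => // [[b e]] u IH /=.
have [-> /= [u0]|ba /=] := eqVneq b a; first by exists [::], e, u.
rewrite add0n => /IH[u1 [e1 [u2 [-> a_u1 a_u2]]]].
by exists ((b, e) :: u1), e1, u2; split=> //=; rewrite (negPf ba).
Qed.

(** The word [s] is what [u = 1] forces [a] to be. All groups are quantified over
    because the same solution serves in the free group, where it defines the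
    automorphism, and in the one-relator group. *)
Definition solution (X : choiceType) (a : X) (u s : word X) : Prop :=
  (forall b, appears b s -> appears b u /\ b <> a) /\
  (forall (H : groupType) (h : X -> H), word_eval h u = 1%g <-> h a = word_eval h s).

(** From u1 a^e u2 = 1 one gets a^e = u1^-1 u2^-1. *)
Lemma solve_letter (X : choiceType) (a : X) (u : word X) :
  appears_once a u -> exists s : word X, solution a u s.
Proof.
move=> a1.
have inv_occ b (v : word X) : occurrences b (word_inv v) = occurrences b v.
  by rewrite /occurrences /word_inv count_rev count_map; apply: eq_count => l.
have [u1 [e [u2 [def_u a_u1 a_u2]]]] := appears_once_split a1.
exists (if e then word_inv u1 ++ word_inv u2 else u2 ++ u1); split.
  move=> b; rewrite /appears => b_s.
  have : 0 < occurrences b u1 + occurrences b u2.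
    move: b_s; case: e def_u => _; rewrite /occurrences count_cat -/(occurrences _ _).
      by rewrite -!/(occurrences _ _) !inv_occ.
    by rewrite addnC.
  move=> b12; split.
    by rewrite def_u /occurrences count_cat /= addnCA addn_gt0 b12 orbT.
  by move=> ba; rewrite ba a_u1 a_u2 in b12.
move=> H h; rewrite def_u word_eval_cat word_eval_cons.
set b1 := word_eval h u1; set b2 := word_eval h u2.
rewrite (fun_if (word_eval h)) !word_eval_cat !word_eval_inv -/b1 -/b2.
case: e {def_u}; split.
- by move=> eq1; apply: (mulgI b1); apply: (mulIg b2); rewrite -!mulgA eq1 mulVg mulg1 mulgV.
- by move=> ->; rewrite !mulgA mulgV mul1g mulVg.
- by move=> /mulg1_eq eq1; rewrite -[LHS](mulgVK b1) eq1 mulVKg.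
- by move=> ->; rewrite invgM -[(_ * _ * b2)%g]mulgA mulVg mulg1 mulgV.
Qed.

(** * The kernel of the exponent map as a free group *)

Lemma appearsP (X : eqType) (a : X) (u : word X) :
  reflect (exists2 l, l \in u & l.1 = a) (0 < occurrences a u).
Proof.
by rewrite /occurrences -has_count; apply: (iffP hasP) => -[l lu /eqP]; exists l => //; apply/eqP.
Qed.

Lemma all_lettersP (X : eqType) (P : pred X) (u : word X) :
  all (fun l => P l.1) u <-> forall a, appears a u -> P a.
Proof.
split=> [/allP Pu a /appearsP[l /Pu Pl <-] //|Pu].
by apply/allP=> l lu; apply: Pu; apply/appearsP; exists l.
Qed.

Lemma all_substitute (X Y : choiceType) (P : pred X) (P' : pred Y) (f : X -> word Y) (u : word X) :
  (forall a, P a -> all (fun l => P' l.1) (f a)) ->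
  all (fun l => P l.1) u -> all (fun l => P' l.1) (substitute f u).
Proof.
move=> Pf; elim: u => //= [[a e]] u IH /andP[/= /Pf Pa /IH Pu].
rewrite /substitute /= all_cat -/(substitute f u) Pu andbT.
by case: e => //; rewrite /word_inv all_rev all_map.
Qed.

(** [wbar] is the rewritten relator, in which the index of [x] ranges from [q] to
    [p]; [rp] and [rq] are its solutions for x_p and x_q. *)
Section MagnusShift.
Variables (A : finType) (x : A) (p q : int) (wbar rp rq : word (A * int)).
Hypothesis wbar_max : forall i : int, appears (x, i) wbar -> (i <= p)%R.
Hypothesis wbar_min : forall i : int, appears (x, i) wbar -> (q <= i)%R.
Hypothesis rp_sol : solution (x, p) wbar rp.
Hypothesis rq_sol : solution (x, q) wbar rq.

Local Notation letter := (A * int)%type.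
Implicit Types (a b : letter) (u v z : word letter) (i j : int).

(** The letters that freely generate the kernel. *)
Definition in_basis a : bool := (a.1 != x) || ((q <= a.2) && (a.2 < p))%R.
Definition basis_word u : bool := all (fun l => in_basis l.1) u.

Definition letter_word a : word letter := [:: (a, true)].
Definition lower_index a : letter := (a.1, int_pred a.2).
Definition raise_index a : letter := (a.1, int_succ a.2).
(** Conjugation by t, on letters of the basis: x_(p-1) goes to x_p, which is not in
    the basis and is replaced by [rp]. *)
Definition shift_up_letter a : word letter :=
  if (a.1 == x) && (int_succ a.2 == p) then rp else letter_word (raise_index a).
(** Conjugation by t^-1: x_q goes to x_(q-1), which the relator translated by -1
    expresses through the basis. *)
Definition shift_down_letter a : word letter :=
  if (a.1 == x) && (a.2 == q) then substitute (fun b => letter_word (lower_index b)) rq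
  else letter_word (lower_index a).
Definition shift_up z := substitute shift_up_letter z.
Definition shift_down z := substitute shift_down_letter z.

Lemma raise_indexK a : lower_index (raise_index a) = a.
Proof. by case: a => y i; rewrite /lower_index /raise_index /= int_predE int_succE addrK. Qed.

Lemma lower_indexK a : raise_index (lower_index a) = a.
Proof. by case: a => y i; rewrite /lower_index /raise_index /= int_predE int_succE subrK. Qed.

Lemma basis_word_rp : basis_word rp.
Proof.
apply/all_lettersP => [[y i]] /(proj1 rp_sol)[yi ne]; rewrite /in_basis /=.
case: eqP yi ne => //= -> yi ne; have := wbar_max yi; have := wbar_min yi.
have : i <> p by move=> eq_ip; rewrite eq_ip in ne.
by lia.
Qed.

Lemma basis_word_up z : basis_word z -> basis_word (shift_up z).
Proof.
apply: all_substitute => [[y i]]; rewrite /shift_up_letter.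
case: ifP => [_ _|/=]; first exact: basis_word_rp.
rewrite /in_basis /= !int_succE andbT; case: eqP => //= _.
by lia.
Qed.

Lemma basis_word_down z : basis_word z -> basis_word (shift_down z).
Proof.
apply: all_substitute => [[y i]]; rewrite /shift_down_letter.
case: ifP => [_ _|/=].
  apply: (all_substitute (P := fun b => in_basis (lower_index b))) => [b /= ->//|].
  apply/(all_lettersP (fun b => in_basis (lower_index b))) => [[y' j]] /(proj1 rq_sol)[yj ne].
  rewrite /in_basis /= int_predE.
  case: eqP yj ne => //= -> yj ne; have := wbar_max yj; have := wbar_min yj.
  have : j <> q by move=> eq_jq; rewrite eq_jq in ne.
  by lia.
rewrite /in_basis /= !int_predE andbT; case: eqP => //= _.
by lia.
Qed.

Local Notation cls u := (free_class u).

(** Only x_(p-1) needs an argument. The homomorphism [shift_down] kills the relator,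
    because it sends x_q to the translate of the solution [rq]; it therefore sends
    [rp] to the image of x_p, which is x_(p-1). *)
Lemma down_up z : basis_word z -> free_eq (shift_down (shift_up z)) z.
Proof.
move=> /all_lettersP z_base; apply/free_eqP.
rewrite free_class_substitute word_eval_substitute [RHS]free_class_eval.
apply: eq_in_word_eval => a /z_base a_base; rewrite /shift_up_letter.
case: ifP => [/andP[/eqP ax /eqP ap]|not_top]; last first.
  rewrite word_eval1 /shift_down_letter ifF ?raise_indexK //.
  case: a a_base {not_top} => y i; rewrite /in_basis /= int_succE.
  by case: eqP => //= _; lia.
have pq : (q < p)%R by move: a_base ap; rewrite /in_basis ax eqxx /= int_succE; lia.
pose h b : free_group letter := cls (shift_down_letter b).
have h_wbar : word_eval h wbar = 1%g.
  apply/(proj2 rq_sol); rewrite {1}/h /shift_down_letter /= !eqxx free_class_substitute.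
  apply: eq_in_word_eval => b /(proj1 rq_sol)[_ /eqP].
  by case: b => y j; rewrite xpair_eqE /h /shift_down_letter /= => /negPf ->.
rewrite -(iffLR (proj2 rp_sol _ h) h_wbar) /h /shift_down_letter /= eqxx gt_eqF //=.
rewrite -[a]raise_indexK; congr (cls (letter_word (lower_index _))).
by rewrite /raise_index ax ap.
Qed.

(** The only letter in question is x_q. Lowering the index and shifting up again is
    the substitution of [rp] for x_p; it kills the relator, hence sends [rq] to the
    image of x_q, which is x_q itself. *)
Lemma up_down z : basis_word z -> free_eq (shift_up (shift_down z)) z.
Proof.
move=> /all_lettersP z_base; apply/free_eqP.
rewrite free_class_substitute word_eval_substitute [RHS]free_class_eval.
apply: eq_in_word_eval => a /z_base a_base; rewrite /shift_down_letter.
case: ifP => [/andP[/eqP ax /eqP aq]|not_bot]; last first.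
  rewrite word_eval1 /shift_up_letter ifF ?lower_indexK //.
  case: a a_base {not_bot} => y i; rewrite /in_basis /= int_succE int_predE.
  by case: eqP => //= _; lia.
have pq : (q < p)%R by move: a_base aq; rewrite /in_basis ax eqxx /=; lia.
rewrite word_eval_substitute.
pose h b : free_group letter := cls (shift_up_letter (lower_index b)).
have -> : word_eval (fun b => word_eval (fun c => cls (shift_up_letter c)) (letter_word (lower_index b))) rq =
    word_eval h rq by apply: eq_in_word_eval => b _; rewrite word_eval1.
have h_single b : b <> (x, p) -> h b = cls (letter_word b).
  case: b => y j ne; rewrite /h /shift_up_letter.
  rewrite -[int_succ _]/(raise_index (lower_index (y, j))).2 lower_indexK ifF //=.
  by apply/negbTE; rewrite -xpair_eqE; apply/eqP.
have h_wbar : word_eval h wbar = 1%g.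
  apply/(proj2 rp_sol); rewrite {1}/h /shift_up_letter /= -[int_succ _]/(raise_index (lower_index (x, p))).2.
  rewrite lower_indexK !eqxx free_class_eval.
  by apply: eq_in_word_eval => b /(proj1 rp_sol)[_ /h_single ->].
rewrite -(iffLR (proj2 rq_sol _ h) h_wbar) h_single; first by case: a ax aq {a_base} => y i /= -> ->.
by case=> qp; rewrite qp ltxx in pq.
Qed.

Lemma up_free_eq u v : free_eq u v -> free_eq (shift_up u) (shift_up v).
Proof. exact: free_eq_substitute. Qed.

Lemma down_free_eq u v : free_eq u v -> free_eq (shift_down u) (shift_down v).
Proof. exact: free_eq_substitute. Qed.

Definition shift_by i z : word letter :=
  match i with Posz n => iter n shift_up z | Negz n => iter n.+1 shift_down z end.

Lemma basis_word_shift i z : basis_word z -> basis_word (shift_by i z).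
Proof.
move=> zb; case: i => n; first by elim: n => //= n; exact: basis_word_up.
by rewrite /shift_by; elim: n.+1 => //= {}n; exact: basis_word_down.
Qed.

Lemma shift_free_eq i u v : free_eq u v -> free_eq (shift_by i u) (shift_by i v).
Proof.
move=> uv; case: i => n; first by elim: n => //= n; exact: up_free_eq.
by rewrite /shift_by; elim: n.+1 => //= {}n; exact: down_free_eq.
Qed.

Lemma shift_cat i u v : shift_by i (u ++ v) = shift_by i u ++ shift_by i v.
Proof.
case: i => n; first by elim: n => //= n ->; exact: substitute_cat.
by rewrite /shift_by; elim: n.+1 => //= {}n ->; exact: substitute_cat.
Qed.

Lemma shift_inv i u : shift_by i (word_inv u) = word_inv (shift_by i u).
Proof.
case: i => n; first by elim: n => //= n ->; exact: substitute_inv.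
by rewrite /shift_by; elim: n.+1 => //= {}n ->; exact: substitute_inv.
Qed.

Lemma up_shift i z : basis_word z -> free_eq (shift_up (shift_by i z)) (shift_by (i + 1) z).
Proof.
move=> zb; rewrite -int_succE; case: i => [n|[|n]]; first exact: pres_refl.
  exact: up_down.
by rewrite [shift_by _ _]/=; apply: up_down; apply: (basis_word_shift (Negz n)).
Qed.

Lemma down_shift i z : basis_word z -> free_eq (shift_down (shift_by i z)) (shift_by (i - 1) z).
Proof.
move=> zb; rewrite -int_predE; case: i => [[|n]|n]; try exact: pres_refl.
by rewrite [shift_by _ _]/=; apply: down_up; apply: (basis_word_shift (Posz n)).
Qed.

Lemma shiftD i j z : basis_word z -> free_eq (shift_by i (shift_by j z)) (shift_by (i + j) z).
Proof.
move=> zb; case: i => n.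
  elim: n => [|n IH]; first by rewrite add0r; exact: pres_refl.
  apply: pres_trans (up_free_eq IH) _; apply: pres_trans (up_shift _ zb) _.
  by rewrite -addn1 PoszD -!addrA [(j + 1)%R]addrC; exact: pres_refl.
elim: n => [|n IH]; first by rewrite NegzE addrC; exact: down_shift.
apply: pres_trans (down_free_eq IH) _; apply: pres_trans (down_shift _ zb) _.
rewrite (_ : (Negz n + j - 1) = Negz n.+1 + j)%R; first exact: pres_refl.
by rewrite !NegzE; lia.
Qed.

(** The generator y is y_0. When y is [x], its index 0 may lie outside the basis, and
    it is reached from x_p = [rp] by conjugation with t^-p. *)
Definition basis_form (y : A) : word letter :=
  if y == x then shift_by (- p) rp else letter_word (y, 0%R).

Lemma basis_word_form y : basis_word (basis_form y).
Proof.
rewrite /basis_form; case: eqP => [_|/eqP yx]; first exact/basis_word_shift/basis_word_rp.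
by rewrite /basis_word /= /in_basis yx.
Qed.

(** The word over the basis that represents the letter y_i, for an arbitrary index. *)
Definition eliminate a : word letter := shift_by a.2 (basis_form a.1).

Lemma down_iter_single k y j :
  (y != x) || (q <= j - k%:Z)%R ->
  iter k shift_down (letter_word (y, j)) = letter_word (y, (j - k%:Z)%R).
Proof.
elim: k => [|k IH] yj; first by rewrite subr0.
rewrite /= IH; last by move: yj; case: eqP => //= _; lia.
rewrite /shift_down /substitute /= cats0 /shift_down_letter /= ifF.
  by congr letter_word; rewrite /lower_index /= int_predE; congr (_, _); lia.
by move: yj; case: eqP => //= _; lia.
Qed.

Lemma up_iter_single k y j :
  y != x -> iter k shift_up (letter_word (y, j)) = letter_word (y, (j + k%:Z)%R).
Proof.
move=> yx; elim: k => [|k IH]; first by rewrite addr0.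
rewrite /= IH /shift_up /substitute /= cats0 /shift_up_letter /= (negPf yx) /=.
by congr letter_word; rewrite /raise_index /= int_succE; congr (_, _); lia.
Qed.

Lemma down_rp : (q < p)%R -> free_eq (shift_down rp) (letter_word (x, (p - 1)%R)).
Proof.
move=> qp; have -> : rp = shift_up (letter_word (x, (p - 1)%R)).
  by rewrite /shift_up /substitute /= cats0 /shift_up_letter /= eqxx int_succE subrK eqxx.
by apply: down_up; rewrite /basis_word /= /in_basis /=; apply/andP; split=> //; lia.
Qed.

Lemma eliminate_top : free_eq (eliminate (x, p)) rp.
Proof.
rewrite /eliminate /basis_form eqxx /=; apply: pres_trans (shiftD _ _ basis_word_rp) _.
by rewrite subrr; exact: pres_refl.
Qed.

(** For x_i with q <= i < p, the first of the p - i downward shifts turns [rp] into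
    x_(p-1), and the others just lower the index. *)
Lemma eliminate_basis a : in_basis a -> free_eq (eliminate a) (letter_word a).
Proof.
case: a => y i; rewrite /eliminate /basis_form /in_basis /=.
case: eqP => [->|/eqP yx _] /=; last first.
  case: i => n; rewrite /shift_by.
    by rewrite up_iter_single // add0r; exact: pres_refl.
  by rewrite down_iter_single ?yx // sub0r NegzE; exact: pres_refl.
case/andP=> qi ip; apply: pres_trans (shiftD _ _ basis_word_rp) _.
have [k def_k] : exists k : nat, (i - p)%R = Negz k.
  by case E: (i - p)%R => [m|m]; [lia | exists m].
rewrite def_k /shift_by iterSr.
have qp : (q < p)%R by lia.
have iter_eq u v : free_eq u v -> free_eq (iter k shift_down u) (iter k shift_down v).
  by move=> uv; elim: (k) => //= n; exact: down_free_eq.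
apply: pres_trans (iter_eq _ _ (down_rp qp)) _.
have def_i : i = (p - 1 - k%:Z)%R by move: def_k; rewrite NegzE; lia.
rewrite down_iter_single -def_i; [exact: pres_refl | by rewrite qi orbT].
Qed.

(** Elimination sends x_p to [rp] and fixes the letters of [rp], so it respects the
    solution of the relator. *)
Lemma eliminate_relator : free_eq (substitute eliminate wbar) [::].
Proof.
apply/free_eqP; rewrite free_class_substitute; apply/(proj2 rp_sol).
rewrite (iffLR (free_eqP _ _) eliminate_top) free_class_eval.
apply: eq_in_word_eval => b b_rp; apply/esym/(iffLR (free_eqP _ _))/eliminate_basis.
by have /all_lettersP := basis_word_rp; apply.
Qed.

(** A pair (z, n) stands for z t^n; the letters of the one-relator group act on such
    pairs by left multiplication. *)
Definition act_letter (l : option A * bool) (Z : word letter * int) : word letter * int :=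
  match l with
  | (None, true) => (shift_up Z.1, int_succ Z.2)
  | (None, false) => (shift_down Z.1, int_pred Z.2)
  | (Some y, e) => ((if e then basis_form y else word_inv (basis_form y)) ++ Z.1, Z.2)
  end.

Definition normal_from (Z : word letter * int) (u : word (option A)) :=
  foldr act_letter Z u.

Definition normal_eq (Z Z' : word letter * int) : Prop :=
  free_eq Z.1 Z'.1 /\ Z.2 = Z'.2.

Lemma normal_from_exponent Z (u : word (option A)) :
  (normal_from Z u).2 = (exponent_sum None u + Z.2)%R.
Proof.
rewrite /exponent_sum; elim: u => [|[[y|] e] u IH]; rewrite ?big_nil ?add0r // big_cons //=.
by case: e; rewrite /= ?int_succE ?int_predE IH addrC addrA.
Qed.

Lemma basis_word_inv u : basis_word u -> basis_word (word_inv u).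
Proof. by rewrite /basis_word /word_inv all_rev all_map. Qed.

Lemma basis_word_normal_from Z (u : word (option A)) :
  basis_word Z.1 -> basis_word (normal_from Z u).1.
Proof.
move=> Zb; elim: u => // [[[y|] e] u] IH; case: e => /=.
- by rewrite /basis_word all_cat; apply/andP; split; first exact: basis_word_form.
- by rewrite /basis_word all_cat; apply/andP; split; first exact/basis_word_inv/basis_word_form.
- exact: basis_word_up.
- exact: basis_word_down.
Qed.

Lemma normal_eq_act_letter l Z Z' : normal_eq Z Z' -> normal_eq (act_letter l Z) (act_letter l Z').
Proof.
case: l => [[y|] e] [Z1 Z2]; split; case: e; rewrite /= ?Z2 //.
- exact: pres_eq_catl.
- exact: pres_eq_catl.
- exact: up_free_eq.
- exact: down_free_eq.
Qed.

Lemma normal_eq_from (u : word (option A)) Z Z' :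
  normal_eq Z Z' -> normal_eq (normal_from Z u) (normal_from Z' u).
Proof. by move=> ZZ'; elim: u => //= l u; exact: normal_eq_act_letter. Qed.

Lemma act_letterK y e Z :
  basis_word Z.1 -> normal_eq (act_letter (y, e) (act_letter (y, ~~ e) Z)) Z.
Proof.
case: y => [y|] Zb; split; case: e; rewrite /= ?int_succE ?int_predE ?addrK ?subrK //.
- by rewrite catA; exact: (pres_eq_catr _ (pres_eq_mulV _ _)).
- by rewrite catA; exact: (pres_eq_catr _ (pres_eq_Vmul _ _)).
- exact: up_down.
- exact: down_up.
Qed.

(** Reading a word letter by letter agrees with Magnus rewriting followed by
    elimination; the accumulator [i] of the rewriting is a conjugation by t^i. *)
Lemma shift_normal_from i Z (u : word (option A)) : basis_word Z.1 ->
  free_eq (shift_by i (normal_from Z u).1)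
    (substitute eliminate (magnus_from i u) ++ shift_by (i + exponent_sum None u)%R Z.1).
Proof.
move=> Zb; elim: u i => [|[[y|] e] u IH] i.
- by rewrite /exponent_sum big_nil addr0; exact: pres_refl.
- rewrite /exponent_sum big_cons /= shift_cat.
  rewrite -[substitute _ (_ :: _)]/((if e then eliminate (y, i) else word_inv (eliminate (y, i)))
    ++ substitute eliminate (magnus_from i u)) -catA.
  rewrite (_ : shift_by i (if e then _ else _) =
    if e then eliminate (y, i) else word_inv (eliminate (y, i))).
    exact: pres_eq_catl (IH i).
  by case: e; rewrite ?shift_inv.
rewrite /exponent_sum big_cons /= addrA; set j := (i + letter_sign e)%R.
apply: pres_trans (IH j); have ub := basis_word_normal_from u Zb.
by case: e @j => /=; [exact: (shiftD i 1) | exact: (shiftD i (-1))].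
Qed.

Lemma shift_nil i : shift_by i [::] = [::].
Proof. by case: i => n; rewrite /shift_by; [elim: n | elim: n.+1] => //= {}n ->. Qed.

Lemma normal_from_split Z (u : word (option A)) : basis_word Z.1 ->
  free_eq (normal_from Z u).1
    ((normal_from ([::], 0%R) u).1 ++ shift_by (exponent_sum None u) Z.1).
Proof.
move=> Zb; apply: pres_trans (shift_normal_from 0 u Zb) _; rewrite add0r.
apply: pres_eq_catr; apply: pres_sym.
have := @shift_normal_from 0 ([::], 0%R) u isT.
by rewrite shift_nil cats0.
Qed.

Section Relator.
Variable w : word (option A).
Hypotheses (w_wbar : magnus w = wbar) (w0 : exponent_sum None w = 0%R).

Lemma normal_from_relator Z : basis_word Z.1 -> normal_eq (normal_from Z w) Z.
Proof.
move=> Zb; split; last by rewrite normal_from_exponent w0 add0r.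
apply: pres_trans (shift_normal_from 0 w Zb) _; rewrite w0 -/(magnus w) w_wbar.
exact: (pres_eq_catr _ eliminate_relator).
Qed.

(** Normal forms are well defined on the one-relator group: this is the homomorphism
    to the semidirect product. *)
Lemma normal_eq_pres_eq Z (u v : word (option A)) : basis_word Z.1 ->
  pres_eq (fun r => r = w) u v -> normal_eq (normal_from Z u) (normal_from Z v).
Proof.
move=> Zb; elim=> {u v} [u|u v _ [? ?]|u v z _ [e1 e2] _ [e3 e4]|u v y e|u v r ->].
- by split=> //; exact: pres_refl.
- by split=> //; exact: pres_sym.
- by split; [exact: pres_trans e1 e3 | rewrite e2].
- rewrite /normal_from !foldr_cat /=; apply: normal_eq_from.
  exact/act_letterK/basis_word_normal_from.
rewrite /normal_from !foldr_cat /=; apply: normal_eq_from.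
exact/normal_from_relator/basis_word_normal_from.
Qed.

End Relator.

End MagnusShift.

(** * Basis words as elements of the one-relator group *)

Section IntegerPower.
Variables (H : groupType) (t : H).

Definition int_power (i : int) : H :=
  match i with Posz n => (t ^+ n)%g | Negz n => (t^-1 ^+ n.+1)%g end.

Lemma int_power_succ i : int_power (i + 1)%R = (t * int_power i)%g.
Proof.
rewrite -int_succE; case: i => [n|[|n]]; first exact: expgS.
  by rewrite /= mulgV.
by rewrite [RHS]/= expgS mulVKg.
Qed.

Lemma int_power_pred i : int_power (i - 1)%R = (t^-1 * int_power i)%g.
Proof. by rewrite -[in RHS](subrK 1%R i) int_power_succ mulKg. Qed.

Lemma int_power_sign i e :
  int_power (i + letter_sign e)%R = (int_power i * (if e then t else t^-1))%g.
Proof.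
have ti : commute t (int_power i).
  by case: i => n; apply: commuteX; rewrite /commute ?mulgV ?mulVg.
case: e; first by rewrite int_power_succ ti.
rewrite int_power_pred; apply: (mulgI t); apply: (mulIg t).
by rewrite mulVKg mulgA mulgVK ti.
Qed.

End IntegerPower.

Section Evaluation.
Variables (A : finType) (w : word (option A)) (x : A) (p q : int) (rp rq : word (A * int)).
Hypothesis w0 : exponent_sum None w = 0%R.
Hypothesis rp_sol : solution (x, p) (magnus w) rp.
Hypothesis rq_sol : solution (x, q) (magnus w) rq.

Local Notation letter := (A * int)%type.
Let G := one_relator_group w.
Let g : option A -> G := letter_class w.
Let t : G := g None.
Local Notation tz := (int_power t).
Local Notation shift_up := (shift_up x p rp).
Local Notation shift_down := (shift_down x q rq).
Local Notation shift_by := (shift_by x p q rp rq).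
Local Notation normal_from := (normal_from x p q rp rq).

(** The element t^i y t^-i for which y_i stands. *)
Definition conj_letter (a : letter) : G := (tz a.2 * g (Some a.1) * (tz a.2)^-1)%g.
Local Notation val := (word_eval conj_letter).

Lemma letter_eval (u : word (option A)) : word_eval g u = class_of (fun r => r = w) u.
Proof. exact: word_eval_pres_gen. Qed.

Lemma relator_eval : word_eval g w = 1%g.
Proof.
rewrite letter_eval; apply/class_ofP.
by have := @pres_rel _ (fun r => r = w) [::] [::] w erefl; rewrite /= cats0.
Qed.

Lemma val_magnus_from i (u : word (option A)) :
  val (magnus_from i u) = (tz i * word_eval g u * (tz (i + exponent_sum None u))^-1)%g.
Proof.
rewrite /exponent_sum; elim: u i => [|[[y|] e] u IH] i.
- by rewrite big_nil addr0 /= !word_eval_nil mulg1 mulgV.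
- rewrite big_cons /= !word_eval_cons IH /conj_letter /=.
  by case: e; rewrite ?invgM ?invgK !mulgA mulgVK.
rewrite big_cons /= word_eval_cons IH addrA int_power_sign -/t.
by rewrite !mulgA.
Qed.

Lemma val_relator : val (magnus w) = 1%g.
Proof. by rewrite val_magnus_from relator_eval w0 /= mulg1 invg1 mulg1. Qed.

Lemma conj_letter_raise a : conj_letter (raise_index a) = (t * conj_letter a * t^-1)%g.
Proof. by rewrite /conj_letter /= int_succE int_power_succ invgM !mulgA. Qed.

Lemma conj_letter_lower a : conj_letter (lower_index a) = (t^-1 * conj_letter a * t)%g.
Proof. by rewrite -[in RHS](lower_indexK a) conj_letter_raise !mulgA mulVg mul1g mulgVK. Qed.

Lemma val_up z : val (shift_up z) = (t * val z * t^-1)%g.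
Proof.
rewrite word_eval_substitute -word_eval_conj; apply: eq_in_word_eval => a _.
rewrite /shift_up_letter -conj_letter_raise; case: ifP => [/andP[/eqP ax /eqP ap]|_].
  by rewrite -(iffLR (proj2 rp_sol _ _) val_relator) /raise_index ax ap.
by rewrite word_eval1.
Qed.

Lemma val_down z : val (shift_down z) = (t^-1 * val z * t)%g.
Proof.
have -> : (t^-1 * val z * t = t^-1 * val z * t^-1^-1)%g by rewrite invgK.
rewrite word_eval_substitute -word_eval_conj; apply: eq_in_word_eval => a _.
rewrite /shift_down_letter; case: ifP => [/andP[/eqP ax /eqP ap]|_]; last first.
  by rewrite word_eval1 conj_letter_lower invgK.
rewrite word_eval_substitute.
rewrite (@eq_in_word_eval _ _ _ (fun b => t^-1 * conj_letter b * t^-1^-1)%g); last first.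
  by move=> b _; rewrite word_eval1 conj_letter_lower invgK.
rewrite word_eval_conj -(iffLR (proj2 rq_sol _ _) val_relator); congr (_ * conj_letter _ * _)%g.
by case: a ax ap => y i /= -> ->.
Qed.

Lemma val_shift i z : val (shift_by i z) = (tz i * val z * (tz i)^-1)%g.
Proof.
case: i => n; rewrite /shift_by [int_power _ _]/=.
  elim: n => [|n IH]; first by rewrite expg0 invg1 mulg1 mul1g.
  by rewrite iterS val_up IH expgS invgM !mulgA.
elim: n.+1 => [|{}n IH]; first by rewrite expg0 invg1 mulg1 mul1g.
by rewrite iterS val_down IH expgS invgM invgK !mulgA.
Qed.

Lemma int_powerNK i : (tz (- i)%R * tz i)%g = 1%g.
Proof.
have H (n : nat) : tz (- n%:Z)%R = (tz n)^-1%g.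
  by case: n => [|n]; [rewrite oppr0 /= invg1 | rewrite -NegzE [LHS]expVgn].
case: i => n; first by rewrite H mulVg.
by rewrite NegzE opprK H mulgV.
Qed.

Lemma val_basis_form y : val (basis_form x p q rp rq y) = g (Some y).
Proof.
rewrite /basis_form; case: eqP => [->|_]; last first.
  by rewrite word_eval1 /conj_letter /= mul1g invg1 mulg1.
rewrite val_shift -(iffLR (proj2 rp_sol _ _) val_relator) /conj_letter /=.
by rewrite !mulgA int_powerNK mul1g -mulgA -invgM int_powerNK invg1 mulg1.
Qed.

(** A word represents z t^n, for (z, n) its normal form; so a word is determined in
    the group by its normal form. *)
Lemma val_normal_from Z (u : word (option A)) :
  (val (normal_from Z u).1 * tz (normal_from Z u).2 = word_eval g u * val Z.1 * tz Z.2)%g.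
Proof.
elim: u => [|[[y|] e] u IH]; first by rewrite word_eval_nil mul1g.
  rewrite word_eval_cons -[normal_from _ _]/(_ ++ (normal_from Z u).1, (normal_from Z u).2).
  rewrite word_eval_cat -!mulgA [(val _ * tz _)%g]IH -!mulgA; congr (_ * _)%g.
  by case: e; rewrite ?word_eval_inv val_basis_form.
rewrite word_eval_cons -2!mulgA [(word_eval g u * _)%g]mulgA -IH -/t.
case: e => /=.
  by rewrite val_up int_succE int_power_succ !mulgA mulgVK.
by rewrite val_down int_predE int_power_pred !mulgA mulgK.
Qed.

End Evaluation.

(** * The automaton of the submonoid *)

Section Spelling.
Variable X : choiceType.
Implicit Types (v : word X).

(** The edges that read [v]. The state (v, m) means that [v] is still to be read
    before the exponent [m] is reached; edges of equal remaining label and target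
    can share their states. *)
Definition spell (m : nat) v : seq ((word X * nat) * (X * bool) * (word X * nat)) :=
  (foldr (fun l s => (l :: s.1, ((l :: s.1, m), l, (s.1, m)) :: s.2)) ([::], [::]) v).2.

Lemma spell_cons m l v : spell m (l :: v) = ((l :: v, m), l, (v, m)) :: spell m v.
Proof.
rewrite /spell /=; set F := foldr _ _.
by have -> : (F v).1 = v by elim: v => //= l' v ->.
Qed.

Lemma spell_path delta eps m v : {subset spell m v <= delta} ->
  nfa_path delta eps (v, m) v ([::], m).
Proof.
elim: v => [|l v IH] sub; first exact: nfa_path_nil.
rewrite spell_cons in sub; apply: nfa_path_cons (IH _); first exact/sub/mem_head.
by move=> d dv; apply: sub; rewrite inE dv orbT.
Qed.

Lemma spell_edge d m v : d \in spell m v -> exists l s, d = ((l :: s, m), l, (s, m)).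
Proof.
elim: v => [|l v IH]; first by [].
by rewrite spell_cons inE => /orP[/eqP ->|/IH //]; exists l, v.
Qed.

End Spelling.

Section Decision.
Variables (A : finType) (x : A) (p q : int) (rp rq : word (A * int)).
Variable gens : seq (word (A * int) * nat).
Local Notation letter := (A * int)%type.
Local Notation shift_up := (shift_up x p rp).

(** The edges that leave the exponents 0, ..., n, as label, source and target. A
    target above [n] is harmless, since exponents never decrease along a path. *)
Definition jumps (n : nat) : seq (word letter * (nat * nat)) :=
  flatten [seq [seq (iter m shift_up d.1, (m, m + d.2)) | d <- gens] | m <- iota 0 n.+1].
Definition letter_edges (n : nat) := flatten [seq spell d.2.2 d.1 | d <- jumps n].
Definition jump_edges (n : nat) : seq ((word letter * nat) * (word letter * nat)) :=
  [seq (([::], d.2.1), (d.1, d.2.2)) | d <- jumps n].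
Definition states (n : nat) : seq (word letter * nat) :=
  ([::], n) :: [seq d.1.1 | d <- letter_edges n] ++ [seq d.2 | d <- letter_edges n]
    ++ [seq d.1 | d <- jump_edges n] ++ [seq d.2 | d <- jump_edges n].

Definition decide_word (u : word (option A)) : bool :=
  let Z := normal_from x p q rp rq ([::], 0%R) u in
  match Z.2 with
  | Posz n => ([::], 0) \in accepting (letter_edges n) (jump_edges n) (states n) ([::], n)
                (reduce Z.1)
  | Negz _ => false
  end.

Lemma jumpsP n d :
  reflect (exists m c, [/\ m <= n, c \in gens & d = (iter m shift_up c.1, (m, m + c.2))])
    (d \in jumps n).
Proof.
apply: (iffP flatten_mapP) => [[m]|[m [c [mn cg ->]]]].
  by rewrite mem_iota ltnS => mn /mapP[c cg ->]; exists m, c.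
by exists m; [rewrite mem_iota ltnS | apply: map_f].
Qed.

Lemma letter_edges_states n d :
  d \in letter_edges n -> (d.1.1 \in states n) && (d.2 \in states n).
Proof. by move=> dn; rewrite !inE !mem_cat !(map_f _ dn) ?orbT. Qed.

Lemma jump_edges_states n d :
  d \in jump_edges n -> (d.1 \in states n) && (d.2 \in states n).
Proof. by move=> dn; rewrite !inE !mem_cat !(map_f _ dn) ?orbT. Qed.

Local Notation path n := (nfa_path (letter_edges n) (jump_edges n)).

Lemma decideP u : decide_word u <->
  exists2 n : nat, (normal_from x p q rp rq ([::], 0%R) u).2 = Posz n &
    exists2 v, path n ([::], 0) v ([::], n) &
      free_eq v (normal_from x p q rp rq ([::], 0%R) u).1.
Proof.
rewrite /decide_word; case: (normal_from _ _ _ _ _ _ u) => z [n|n] /=; last first.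
  by split=> // -[].
have nS : ([::], n) \in states n by exact: mem_head.
have aP := acceptingP (@letter_edges_states n) (@jump_edges_states n) ([::], 0) z nS.
split=> [/aP H|[_ [<-] /aP //]].
by exists n.
Qed.

Lemma jump_path n m c : m <= n -> c \in gens ->
  path n ([::], m) (iter m shift_up c.1) ([::], m + c.2).
Proof.
move=> mn cg.
have d_n : (iter m shift_up c.1, (m, m + c.2)) \in jumps n by apply/jumpsP; exists m, c.
apply: (@nfa_path_eps _ _ _ _ _ (iter m shift_up c.1, m + c.2)).
  exact: (map_f (fun d => (([::], d.2.1), (d.1, d.2.2))) d_n).
apply: spell_path => d dv; apply/flatten_mapP; eexists; first exact: d_n.
exact: dv.
Qed.

End Decision.

Section Correctness.
Variables (A : finType) (w : word (option A)) (x : A) (p q : int) (rp rq : word (A * int)).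
Hypothesis w0 : exponent_sum None w = 0%R.
Hypothesis w_max : forall i : int, appears (x, i) (magnus w) -> (i <= p)%R.
Hypothesis w_min : forall i : int, appears (x, i) (magnus w) -> (q <= i)%R.
Hypothesis rp_sol : solution (x, p) (magnus w) rp.
Hypothesis rq_sol : solution (x, q) (magnus w) rq.
Variables (k : nat) (ws : 'I_k -> word (option A)) (degree : 'I_k -> nat).
Hypothesis ws_degree : forall i, exponent_sum None (ws i) = degree i.

Local Notation letter := (A * int)%type.
Let G := one_relator_group w.
Let g : option A -> G := letter_class w.
Let t : G := g None.
Let M : G -> Prop := gen_submonoid (fun a => exists i, a = word_eval g (ws i)).
Local Notation shift_up := (shift_up x p rp).
Local Notation normal u := (normal_from x p q rp rq ([::], 0%R) u).
Local Notation val := (word_eval (@conj_letter A w)).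

Definition normal_gens : seq (word letter * nat) :=
  [seq ((normal (ws i)).1, degree i) | i : 'I_k].

Local Notation letter_edges := (letter_edges x p rp normal_gens).
Local Notation jump_edges := (jump_edges x p rp normal_gens).
Local Notation path n := (nfa_path (letter_edges n) (jump_edges n)).

(** The state (v, m) is worth v t^m in the group: reading y on the way to (v', m')
    means that y v' t^m' = v t^m a for some a in the submonoid. *)
Lemma path_submonoid n s v s' : path n s v s' ->
  exists2 a, M a & (val v * val s'.1 = val s.1 * t ^+ s.2 * a * (t ^+ s'.2)^-1)%g.
Proof.
elim=> {s v s'} [s|s s1 s2 v|s l s1 s2 v].
- exists 1%g; first exact: gen_submonoid1.
  by rewrite word_eval_nil mul1g mulg1 mulgK.
- case/mapP=> d /jumpsP[m [c [_ /imageP[i _ ->] ->]]] [-> ->] /= _ [a Ma ->].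
  exists (word_eval g (ws i) * a)%g.
    by apply: gen_submonoidM Ma; apply: gen_submonoid_gen; exists i.
  rewrite word_eval_nil mul1g; congr (_ * _)%g; rewrite mulgA; congr (_ * _)%g.
  have -> : iter m shift_up (normal (ws i)).1 = shift_by x p q rp rq m (normal (ws i)).1 by [].
  rewrite (val_shift w0 rp_sol rq_sol) /= expgnDr -!mulgA; congr (_ * _)%g.
  have := val_normal_from w0 rp_sol rq_sol ([::], 0%R) (ws i).
  rewrite normal_from_exponent ws_degree addr0 /= word_eval_nil !mulg1 => <-.
  by rewrite mulKg.
case/flatten_mapP=> d _ /spell_edge[l' [s' [-> -> ->]]] _ [a Ma IH].
by exists a => //; rewrite -cat1s -[(l' :: s', _).1]cat1s !word_eval_cat -mulgA IH /= !mulgA.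
Qed.

Lemma submonoid_product a : M a ->
  exists js : seq 'I_k, a = class_of _ (flatten [seq ws i | i <- js]).
Proof.
elim=> {a} [|a [i ->]|a b _ [js ->] _ [js' ->]].
- by exists [::].
- by exists [:: i]; rewrite /= cats0; exact: letter_eval.
by exists (js ++ js'); rewrite map_cat flatten_cat; exact: pres_mulE.
Qed.

(** The normal form of a product w_i u is z_i followed by the normal form of u
    conjugated by t^(s_i), which is how paths are concatenated. *)
Lemma product_path n m js : m + \sum_(i <- js) degree i <= n ->
  exists2 v, path n ([::], m) v ([::], m + \sum_(i <- js) degree i) &
    free_eq v (iter m shift_up (normal (flatten [seq ws i | i <- js])).1).
Proof.
elim: js m => [|i js IH] m le_n.
  exists [::]; first by rewrite big_nil addn0; exact: nfa_path_nil.
  by rewrite [X in free_eq _ X](shift_nil x p q rp rq m); exact: pres_refl.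
rewrite big_cons addnA in le_n *; have [v v_path v_eq] := IH _ le_n.
exists (iter m shift_up (normal (ws i)).1 ++ v).
  apply: nfa_path_cat v_path.
  apply: (jump_path x p rp (c := ((normal (ws i)).1, degree i))); last exact: image_f.
  by apply: leq_trans le_n; rewrite -addnA leq_addr.
set rest := flatten _ in v_eq *.
have -> : normal (flatten [seq ws i0 | i0 <- i :: js]) =
    normal_from x p q rp rq (normal rest) (ws i) by exact: foldr_cat.
have rest_b : basis_word x p q (normal rest).1.
  exact: (basis_word_normal_from w_max w_min rp_sol rq_sol (Z := ([::], 0%R))).

have := normal_from_split w_max w_min rp_sol rq_sol (ws i) rest_b.
rewrite ws_degree => split_eq.
have /(shift_free_eq x p q rp rq m) := split_eq.
move=> e; apply: pres_trans (pres_sym e); rewrite shift_cat.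
apply: pres_eq_catl; apply: pres_trans v_eq _.
by rewrite iterD; exact: pres_refl.
Qed.

Lemma decide_submonoid u : M (word_eval g u) <-> decide_word x p q rp rq normal_gens u.
Proof.
rewrite decideP; split=> [|[n n_u [v v_path v_eq]]]; last first.
  have [a Ma] := path_submonoid v_path.
  have -> : val v = val (normal u).1.
    exact: (word_eval_pres_eq (R := fun _ => False)) v_eq.
  rewrite !word_eval_nil !mul1g mulg1 => val_u.
  have := val_normal_from w0 rp_sol rq_sol ([::], 0%R) u.
  by rewrite val_u n_u /= word_eval_nil !mulg1 mulgVK => <-.
rewrite letter_eval => /submonoid_product[js /class_ofP u_js].
have := normal_eq_pres_eq w_max w_min rp_sol rq_sol
  erefl w0 (Z := ([::], 0%R)) isT u_js.
case=> z_eq n_eq; exists (\sum_(i <- js) degree i).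
  rewrite n_eq normal_from_exponent addr0 /exponent_sum; elim: (js) => [|i js' IH].
    by rewrite !big_nil.
  by rewrite /= big_cat big_cons PoszD -IH -ws_degree.
have [v v_path v_eq] := @product_path (\sum_(i <- js) degree i) 0 js (leqnn _).
exists v => //; apply: pres_trans v_eq _; exact: pres_sym.
Qed.

End Correctness.

(** * Computability of the decision procedure *)

(** Computability of a function is read off from the term that defines it. *)
Ltac computable_step :=
  cbv beta;
  match goal with
  | |- computable (fun e => e) => exact: computable_id
  | |- computable (fun _ => ?c) => exact: computable_const
  | H : computable ?f |- computable (fun e => ?f (@?a e)) => apply: (computable_comp H)
  | H : computable ?f |- computable ?f => exact: H
  | |- computable fst => exact: (computable_fst (computable_id _))
  | |- computable snd => exact: (computable_snd (computable_id _))
  | |- computable (fun e => (_, _)) => apply: computable_pair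
  | |- computable (fun e => fst _) => apply: computable_fst
  | |- computable (fun e => snd _) => apply: computable_snd
  | |- computable (fun e => if _ then _ else _) => apply: computable_if
  | |- computable (fun e => _ && _) => apply: computable_and
  | |- computable (fun e => _ || _) => apply: computable_or
  | |- computable (fun e => ~~ _) => apply: computable_neg
  | |- computable (fun e => _ == _) => apply: computable_eq
  | |- computable (fun e => _.+1) => apply: computable_succ
  | |- computable (fun e => _ + _) => apply: computable_add
  | |- computable (fun e => _ :: _) => apply: computable_cons
  | |- computable (fun e => _ ++ _) => apply: computable_cat
  | |- computable (fun e => size _) => apply: computable_size
  | |- computable (fun e => rev _) => apply: computable_rev
  | |- computable (fun e => flatten _) => apply: computable_flatten
  | |- computable (fun e => _ \in _) => apply: computable_mem
  | |- computable (fun e => iota 0 _) => apply: computable_iota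
  | |- computable (fun e => map _ _) => apply: computable_map
  | |- computable (fun e => filter _ _) => apply: computable_filter
  | |- computable (fun e => has _ _) => apply: computable_has
  | |- computable (fun e => foldr _ _ _) => apply: computable_foldr
  | |- computable (fun e => iter _ _ _) => apply: computable_iter
  | |- computable (fun e => int_succ _) => apply: computable_int_succ
  | |- computable (fun e => int_pred _) => apply: computable_int_pred
  end.
Ltac computability := repeat computable_step.

Section ComputableWords.
Variables (E X : countType).

Lemma computable_word_inv (u : E -> word X) :
  computable u -> computable (fun e => word_inv (u e)).
Proof. by move=> cu; rewrite /word_inv; computability. Qed.

Lemma computable_reduce (u : E -> word X) :
  computable u -> computable (fun e => reduce (u e)).
Proof.
move=> cu; rewrite /reduce; computability.
rewrite /reduce_cons; apply: computable_case_seq; computability.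
by rewrite /letter_inv; computability.
Qed.

End ComputableWords.

Lemma computable_substitute (E X Y : countType) (f : X -> word Y) (u : E -> word X) :
  computable f -> computable u -> computable (fun e => substitute f (u e)).
Proof.
move=> cf cu; rewrite /substitute; computability.
by apply: computable_word_inv; computability.
Qed.

Lemma computable_accepting (E X Q : countType)
    (delta : E -> seq (Q * (X * bool) * Q)) (eps : E -> seq (Q * Q)) (S : E -> seq Q)
    (r : E -> Q) (z : E -> word X) :
  computable delta -> computable eps -> computable S -> computable r -> computable z ->
  computable (fun e => accepting (delta e) (eps e) (S e) (r e) (z e)).
Proof.
move=> c_delta c_eps c_S c_r c_z.
have c_pairs : computable (fun e => trivial_pairs (delta e) (eps e) (S e)).
  rewrite /trivial_pairs /grow /trivial_step /letter_inv; computability.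
by rewrite /accepting; computability; apply: (computable_comp c_pairs); computability.
Qed.

Section ComputableDecision.
Variables (A : finType) (x : A) (p q : int) (rp rq : word (A * int)).
Variable gens : seq (word (A * int) * nat).
Local Notation letter := (A * int)%type.

Lemma computable_up (E : countType) (z : E -> word letter) :
  computable z -> computable (fun e => shift_up x p rp (z e)).
Proof.
move=> cz; rewrite /shift_up; apply: computable_substitute => //.
by rewrite /shift_up_letter /letter_word /raise_index; computability.
Qed.

Lemma computable_down (E : countType) (z : E -> word letter) :
  computable z -> computable (fun e => shift_down x q rq (z e)).
Proof.
move=> cz; rewrite /shift_down; apply: computable_substitute => //.
by rewrite /shift_down_letter /letter_word /lower_index; computability.
Qed.

Lemma computable_normal_from (E : countType) (u : E -> word (option A)) :
  computable u -> computable (fun e => normal_from x p q rp rq ([::], 0%R) (u e)).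
Proof.
move=> cu.
pose front (l : option A * bool) : word letter :=
  if l.1 is Some y then
    if l.2 then basis_form x p q rp rq y else word_inv (basis_form x p q rp rq y)
  else [::].
have c_front : computable front by exact: computable_fin.
have c : computable (fun e => foldr (fun l Z =>
    if l.1 == None then
      if l.2 then (shift_up x p rp Z.1, int_succ Z.2) else (shift_down x q rq Z.1, int_pred Z.2)
    else (front l ++ Z.1, Z.2)) ([::], 0%R) (u e)).
  computability; [apply: computable_up | apply: computable_down]; computability.
apply: eq_computable c _ => e; rewrite /normal_from.
by elim: (u e) => // [[[y|] b] v] /= ->; case: b.
Qed.

Lemma computable_jumps (E : countType) (n : E -> nat) :
  computable n -> computable (fun e => jumps x p rp gens (n e)).
Proof.
move=> cn; rewrite /jumps; computability.
by apply: computable_up; computability.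
Qed.

Lemma computable_spell (E X : countType) (m : E -> nat) (v : E -> word X) :
  computable m -> computable v -> computable (fun e => spell (m e) (v e)).
Proof. by move=> cm cv; rewrite /spell; computability. Qed.

Lemma computable_letter_edges (E : countType) (n : E -> nat) :
  computable n -> computable (fun e => letter_edges x p rp gens (n e)).
Proof.
move=> cn; have cj := computable_jumps cn; rewrite /letter_edges; computability.
by apply: computable_spell; computability.
Qed.

Lemma computable_jump_edges (E : countType) (n : E -> nat) :
  computable n -> computable (fun e => jump_edges x p rp gens (n e)).
Proof.
by move=> cn; have cj := computable_jumps cn; rewrite /jump_edges; computability.
Qed.

Lemma computable_states (E : countType) (n : E -> nat) :
  computable n -> computable (fun e => states x p rp gens (n e)).
Proof.
move=> cn; have cl := computable_letter_edges cn; have cj := computable_jump_edges cn.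
by rewrite /states; computability.
Qed.

Lemma computable_decide (E : countType) (u : E -> word (option A)) :
  computable u -> computable (fun e => decide_word x p q rp rq gens (u e)).
Proof.
move=> cu; have c_normal := computable_normal_from cu; rewrite /decide_word.
apply: computable_int_case; [by computability | | by computability].
computability; apply: computable_accepting; try by computability.
- by apply: computable_letter_edges; computability.
- by apply: computable_jump_edges; computability.
- by apply: computable_states; computability.
by apply: computable_reduce; computability; apply: (computable_comp c_normal); computability.
Qed.

End ComputableDecision.

(** [word_code] numbers letters by rank and sign, which need not be their [pickle]
    codes; the word is therefore first rebuilt from the list of these numbers. *)
Lemma decidable_words_computable (B : finType) (P : word B -> Prop) (D : word B -> bool) :
  computable D -> (forall u, P u <-> D u) -> decidable_words P.
Proof.
move=> cD PD.
have [b0 _|B0] := pickP (@predT B); last first.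
  have no_letters (u : word B) : u = [::] by case: u => // [[b e]] u; have := B0 b.
  exists (fun _ => D [::]); first exact: recursive_const.
  by move=> u; rewrite (no_letters u) PD; case: (D _).
pose decode (n : nat) : B * bool := (nth b0 (enum B) n./2, odd n).
have c_decode : computable decode.
  have c_half : computable half by exists half => //; exact: recursive1_half.
  have c_odd : computable odd by exists odd => //; exact: recursive1_odd.
  apply: computable_pair c_odd.
  exact: computable_nth (computable_const _ _) c_half.
have c_words : computable (fun s : seq nat => [seq decode n | n <- s]) by computability.
have [f rf fE] := computable_comp cD c_words.
exists (fun v => f (thead v)) => // u; rewrite PD.
have -> : f (thead [tuple word_code u]) = D u.
  have code_pickle (s : seq nat) : CodeSeq.code s = pickle s.
    by rewrite -[RHS]/(CodeSeq.code (map id s)) map_id.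
  rewrite theadE /word_code code_pickle fE.
  rewrite -map_comp map_id_in // => [[b e]] _ /=; rewrite /decode halfD odd_double.
  by case: e; rewrite /= oddD odd_double /= doubleK ?add0n ?addn0 nth_enum_rank.
by case: (D u).
Qed.

Theorem theorem3p1 (A : finType) (w : word (option A))
    (hw : exponent_sum None w = 0%R)
    (hx : exists (x : A) (p q : int),
        [/\ is_max_index (magnus w) x p,
            is_min_index (magnus w) x q,
            appears_once (x, p) (magnus w)
          & appears_once (x, q) (magnus w)])
    (k : nat) (ws : 'I_k -> word (option A))
    (hws : forall i : 'I_k, (0 <= exponent_sum None (ws i))%R) :
  decidable_membership (letter_class w)
    (gen_submonoid
       (fun g : one_relator_group w =>
          exists i : 'I_k, g = word_eval (letter_class w) (ws i))).
Proof.
case: hx => x [p [q [[_ w_max] [_ w_min]]]].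
move=> /solve_letter[rp rp_sol] /solve_letter[rq rq_sol].
have [degree ws_degree] : exists d : 'I_k -> nat, forall i, exponent_sum None (ws i) = d i.
  exists (fun i => absz (exponent_sum None (ws i))) => i.
  by rewrite gez0_abs.
apply: decidable_words_computable (decide_submonoid hw w_max w_min rp_sol rq_sol ws_degree).
exact: computable_decide (computable_id _).
Qed.
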